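(* Let $\rho$ be a state such that for every $\epsilon>0$ there is $c$ with $QK^{\epsilon}(\rho_n)>n-c$ for all $n$. Then for every rational $s\in(0,1)$ and every function $\phi$ admissible for $s$, $\rho$ passes every $(\phi,s)$-strong Solovay test.
   Context: Let $\mathbb{U}$ be a fixed universal prefix-free Turing machine. Finite sets of vectors with complex algebraic entries are coded by natural numbers via a fixed canonical effective indexing; $\mathbb{U}(\sigma)\downarrow=F$ means that $\mathbb{U}$ on input $\sigma$ halts and outputs the code of $F$. $\mathbb{C}^{2^n}_{alg}$ denotes the vectors in $\mathbb{C}^{2^n}$ with complex algebraic entries. Logarithms are base 2. For a density matrix $\tau$ on $\mathbb{C}^{2^{n}}$ write $|\tau|=n$, and for $\epsilon>0$ define $QK^{\epsilon}(\tau)=\inf\{|\sigma|+\log|F| : \mathbb{U}(\sigma)\downarrow=F,\ F \text{ an orthonormal subset of } \mathbb{C}^{2^{|\tau|}}_{alg},\ \sum_{v\in F}\langle v|\tau|v\rangle>\epsilon\}$, with $\inf\emptyset=\infty$. A state is a sequence $\rho=(\rho_n)_{n\in\mathbb{N}}$ of density matrices $\rho_n$ on $\mathbb{C}^{2^n}$ such that the partial trace of $\rho_n$ over the last qubit equals $\rho_{n-1}$. A special projection is a Hermitian projection matrix with complex algebraic entries. For a special projection $S$ on $\mathbb{C}^{2^n}$ put $\tau(S)=2^{-n}\operatorname{Tr}(S)$ and $\rho(S)=\operatorname{Tr}(\rho_nS)$. A strong Solovay test is a computable sequence $(S^m)_m$ of special projections with $\sum_m\tau(S^m)<\infty$; $\rho$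 fails it at level $\epsilon>0$ if $\rho(S^m)>\epsilon$ for infinitely many $m$, and passes it if it fails it at no level $\epsilon>0$. For rational $s\in(0,1)$, a function $\phi$ is admissible for $s$ if $\phi$ is a computable, non-decreasing, non-negative function on the reals such that there is a constant $C>0$ with $C\phi(sr)\ge s\phi(r)$ for all $r$, and $\sum_{n\in\mathbb{N}}2^{-n}\phi(n)<\infty$. A $(\phi,s)$-strong Solovay test is a strong Solovay test $(S^r)_r$ such that $\sum_r \tau(S^r)^s/\phi(-\log\tau(S^r))<\infty$ and $\sum_r\tau(S^r)$ is a computable real number. *)

(* Defs.v *)
From HB Require Import structures.
From mathcomp Require Import all_boot all_order all_algebra.
From mathcomp Require Import all_classical all_reals all_analysis.
From mathcomp Require Import complex.
Set Implicit Arguments.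
Unset Strict Implicit.
Unset Printing Implicit Defensive.
Import Order.TTheory GRing.Theory Num.Theory.
Import numFieldNormedType.Exports.

Definition npair (a b : nat) : nat := ((a + b) * (a + b).+1) %/ 2 + b.

Fixpoint nunpair (n : nat) : nat * nat :=
  match n with
  | 0 => (0, 0)
  | k.+1 => let: (a, b) := nunpair k in
            if a is a'.+1 then (a', b.+1) else (b.+1, 0)
  end.

Inductive prog : Type :=
| pZero
| pSucc
| pFst
| pSnd
| pOracle
| pPair of prog & prog
| pComp of prog & prog
| pPrec of prog & prog
| pMin of prog.

Inductive eval (g : nat -> nat) : prog -> nat -> nat -> Prop :=
| ev_zero x : eval g pZero x 0
| ev_succ x : eval g pSucc x x.+1
| ev_fst x : eval g pFst x (nunpair x).1
| ev_snd x : eval g pSnd x (nunpair x).2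
| ev_oracle x : eval g pOracle x (g x)
| ev_pair f h x y z : eval g f x y -> eval g h x z -> eval g (pPair f h) x (npair y z)
| ev_comp f h x y z : eval g h x y -> eval g f y z -> eval g (pComp f h) x z
| ev_prec0 f h x a y : nunpair x = (a, 0) -> eval g f a y -> eval g (pPrec f h) x y
| ev_precS f h x a n z y : nunpair x = (a, n.+1) ->
    eval g (pPrec f h) (npair a n) z -> eval g h (npair a (npair n z)) y ->
    eval g (pPrec f h) x y
| ev_min f x n (k : nat -> nat) : eval g f (npair x n) 0 ->
    (forall m, m < n -> eval g f (npair x m) (k m).+1) ->
    eval g (pMin f) x n.

Definition noOracle : nat -> nat := fun _ => 0.

(* Machines on binary strings: inputs are coded by the canonical (effective)
   countType coding of [seq bool]. *)
Definition runs (M : prog) (sigma : seq bool) (y : nat) : Prop :=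
  eval noOracle M (pickle sigma) y.

Definition halts (M : prog) (sigma : seq bool) : Prop := exists y, runs M sigma y.

Definition prefix_free (M : prog) : Prop :=
  forall sigma tau, halts M sigma -> halts M (sigma ++ tau) -> tau = [::].

Definition universal_prefix_free (U : prog) : Prop :=
  prefix_free U /\
  forall M, prefix_free M ->
    exists rho : seq bool, forall sigma y, runs M sigma y <-> runs U (rho ++ sigma) y.

Section Quantum.
Variable R : realType.
Local Notation C := (complex R).
Local Open Scope ring_scope.

Definition algebraicC (z : C) : Prop :=
  exists p : {poly rat}, p != 0 /\ root (map_poly ratr p) z.

Definition codesAlg (k : nat) (z : C) : Prop :=
  exists (cs : seq int) (a b c d : rat),
    unpickle k = Some (cs, (a, b, c, d)) /\
    let p : {poly C} := Poly (map (fun i : int => i%:~R) cs) in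
    [/\ p != 0, root p z,
        ratr a <= complex.Re z <= ratr b,
        ratr c <= complex.Im z <= ratr d &
        forall w, root p w -> ratr a <= complex.Re w <= ratr b ->
                  ratr c <= complex.Im w <= ratr d -> w = z].

Definition codesVecs (k n : nat) (F : seq 'cV[C]_(2 ^ n)) : Prop :=
  exists ls : seq (seq nat),
    unpickle k = Some ls /\ (size ls = size F)%N /\
    forall i, (i < size F)%N ->
      (size (nth [::] ls i) = 2 ^ n)%N /\
      forall j : 'I_(2 ^ n), codesAlg (nth 0 (nth [::] ls i) j) ((nth 0 F i) j 0).

Definition codesMx (k n : nat) (S : 'M[C]_(2 ^ n)) : Prop :=
  exists rows : seq (seq nat),
    unpickle k = Some (n, rows) /\ (size rows = 2 ^ n)%N /\
    forall i j : 'I_(2 ^ n),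
      (size (nth [::] rows i) = 2 ^ n)%N /\ codesAlg (nth 0 (nth [::] rows i) j) (S i j).

Definition adj {m n} (A : 'M[C]_(m, n)) : 'M[C]_(n, m) := (map_mx Num.conj A)^T.

Definition is_density {n} (M : 'M[C]_n) : Prop :=
  [/\ adj M = M,
      forall v : 'cV[C]_n, 0 <= complex.Re ((adj v *m M *m v) 0 0) &
      \tr M = 1].

Lemma qidx_proof k (a : 'I_(2 ^ k)) (c : 'I_2) : (2 * a + c < 2 ^ k.+1)%N.
Proof.
have ha := ltn_ord a; have hc := ltn_ord c.
rewrite expnS; apply: (@leq_trans (2 * a + 2)); first by rewrite ltn_add2l.
by rewrite -mulnSr leq_mul2l.
Qed.

(* Basis index |a> (x) |c> with the last qubit c the least significant bit. *)
Definition qidx k (a : 'I_(2 ^ k)) (c : 'I_2) : 'I_(2 ^ k.+1) := Ordinal (qidx_proof a c).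

Definition ptrace_last k (M : 'M[C]_(2 ^ k.+1)) : 'M[C]_(2 ^ k) :=
  \matrix_(a, b) \sum_(c < 2) M (qidx a c) (qidx b c).

Definition is_state (rho : forall n, 'M[C]_(2 ^ n)) : Prop :=
  (forall n, is_density (rho n)) /\ (forall n, ptrace_last (rho n.+1) = rho n).

Definition is_special_projection {n} (S : 'M[C]_n) : Prop :=
  [/\ adj S = S, S *m S = S & forall i j, algebraicC (S i j)].

(* tau(S) = 2^-n Tr S   and   rho(S) = Tr (rho_n S)  (both real). *)
Definition tauS (S : {n : nat & 'M[C]_(2 ^ n)}) : R :=
  complex.Re (\tr (projT2 S)) / (2 ^ projT1 S)%:R.

Definition rhoS (rho : forall n, 'M[C]_(2 ^ n)) (S : {n : nat & 'M[C]_(2 ^ n)}) : R :=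
  complex.Re (\tr (rho (projT1 S) *m projT2 S)).

Definition log2 (x : R) : R := ln x / ln 2.

Definition orthonormal {m} (F : seq 'cV[C]_m) : Prop :=
  forall i j, (i < size F)%N -> (j < size F)%N ->
    (adj (nth 0 F i) *m nth 0 F j) 0 0 = (i == j)%:R.

Definition qk_witness (U : prog) (eps : R) n (tau : 'M[C]_(2 ^ n))
    (sigma : seq bool) (F : seq 'cV[C]_(2 ^ n)) : Prop :=
  exists k, [/\ runs U sigma k, codesVecs k F, orthonormal F,
    (forall v, v \in F -> forall i, algebraicC (v i 0)) &
    \sum_(v <- F) complex.Re ((adj v *m tau *m v) 0 0) > eps].

(* QK^eps(tau) = inf { |sigma| + log |F| : ... }, inf of the empty set = +oo. *)
Definition QK (U : prog) (eps : R) n (tau : 'M[C]_(2 ^ n)) : \bar R :=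
  ereal_inf [set x : \bar R | exists sigma F, qk_witness U eps tau sigma F /\
                 x = ((size sigma)%:R + log2 (size F)%:R)%:E].

(* Rationals are coded by the canonical effective countType coding. *)
Definition decodeQ (k : nat) : rat := odflt 0 (unpickle k).

Definition names (x : R) (h : nat -> nat) : Prop :=
  forall n, `|x - ratr (decodeQ (h n))| <= 2 ^- n.

Definition computable_real (x : R) : Prop :=
  exists (e : prog) (h : nat -> nat), (forall n, eval noOracle e n (h n)) /\ names x h.

Definition computable_fun (f : R -> R) : Prop :=
  exists e : prog, forall x (g : nat -> nat), names x g ->
    exists h : nat -> nat, (forall n, eval g e n (h n)) /\ names (f x) h.

Definition computable_proj_seq (S : nat -> {n : nat & 'M[C]_(2 ^ n)}) : Prop :=
  exists e : prog, forall m, exists k, eval noOracle e m k /\ codesMx k (projT2 (S m)).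

Definition strong_solovay_test (S : nat -> {n : nat & 'M[C]_(2 ^ n)}) : Prop :=
  [/\ computable_proj_seq S,
      forall m, is_special_projection (projT2 (S m)) &
      cvgn (series (fun m => tauS (S m)))].

Definition fails_at (rho : forall n, 'M[C]_(2 ^ n)) (S : nat -> {n : nat & 'M[C]_(2 ^ n)})
    (eps : R) : Prop :=
  forall N, exists m, (N <= m)%N /\ rhoS rho (S m) > eps.

Definition passes (rho : forall n, 'M[C]_(2 ^ n)) (S : nat -> {n : nat & 'M[C]_(2 ^ n)}) : Prop :=
  forall eps : R, 0 < eps -> ~ fails_at rho S eps.

Definition admissible (s : R) (phi : R -> R) : Prop :=
  [/\ computable_fun phi,
      forall x y, x <= y -> phi x <= phi y,
      forall x, 0 <= phi x,
      exists C : R, 0 < C /\ forall r, s * phi r <= C * phi (s * r) &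
      cvgn (series (fun n : nat => 2 ^- n * phi n%:R))].

(* (phi,s)-strong Solovay test.  The condition
     sum_r tau(S^r)^s / phi(-log tau(S^r)) < oo
   is written out as: every term with tau(S^r) > 0 has a positive
   denominator (otherwise the term is +oo), and the real series converges
   (terms with tau(S^r) = 0, i.e. S^r = 0, contribute 0). *)
Definition phi_s_test (s : R) (phi : R -> R) (S : nat -> {n : nat & 'M[C]_(2 ^ n)}) : Prop :=
  [/\ strong_solovay_test S,
      forall r, 0 < tauS (S r) -> 0 < phi (- log2 (tauS (S r))),
      cvgn (series (fun r => tauS (S r) `^ s / phi (- log2 (tauS (S r))))) &
      computable_real (limn (series (fun r => tauS (S r))))].

End Quantum.

(* Main.v *)
Require Import Defs.
From HB Require Import structures.
From mathcomp Require Import all_boot all_order all_algebra.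
From mathcomp Require Import all_classical all_reals all_analysis.
From mathcomp Require Import complex spectral.
From mathcomp Require Import zify ring lra.
Set Implicit Arguments.
Unset Strict Implicit.
Unset Printing Implicit Defensive.
Import Order.TTheory GRing.Theory Num.Theory.
Import numFieldNormedType.Exports.

(** Only the computability of [sum_r tau(S^r)] matters.  It gives a computable
    [N] with [sum_(r >= N k) tau(S^r) <= 4^-k].  Write [F_r] for an orthonormal
    family spanning (approximately) the range of [S^r], so that
    [|F_r| = 2^n tau(S^r)].  For each [k] the numbers [4^k tau(S^r)], [r >= N k],
    sum to at most 1 and hence are the lengths of disjoint subintervals of
    [[0, 1]]; naming such an interval by a dyadic subinterval, after the prefix
    [0^k 1], is a prefix-free code in which [F_r] has a description of length
    at most [- log tau(S^r) - k + O(1)].  Then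
    [QK^(eps/2)(rho_n) <= n - k + O(1)] whenever [rho(S^r) > eps], which bounds [k].

    The family [F_r] has to be computed from a code of [S^r].  Exact arithmetic on
    algebraic numbers is avoided by searching for an orthonormal family with
    entries in [Q(i)] whose projection is entrywise close to [S^r].  Such families
    exist by the spectral theorem and because rational unitary matrices are dense
    (Cayley transform of rational skew-Hermitian matrices).  Closeness to an
    algebraic number isolated by a box is certified by evaluating its polynomial
    on a fine grid of the box.  The rank is then exact since the traces are
    integers at distance less than 1. *)

(** The constant in the universality of [U] depends on the machine, so all [k] must be served by one
    machine, and the word itself has to carry [k]. This is why the tails are scaled by [4^k] and not
    by [2^k]: half of the gain of [2k] bits pays for the marker [0^k 1], the other half is the
    saving that contradicts the lower bound. The definition of [QK] asks for exact orthonormality,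
    so eigenvectors cannot be rounded one by one. Rounding is done on a skew-Hermitian matrix, where
    the constraint is linear, and carried over by the Cayley transform. That transform misses the
    unitary matrices with eigenvalue -1. Multiplying by a phase moves the spectrum away from -1, and
    the phase cancels in the projection. The search for a family never decides an equality:
    closeness is certified by a test that is sound at every fineness of the grid and succeeds at
    every large one. The tolerance shrinks like [8^-n] because the error in [rho(S)] adds up over
    [4^n] entries and has to be bounded independently of [n]. *)

Local Notation eval := Defs.eval.

(** * Computable functions on countable types *)

(** Induction on the derivation. For [pMin], two different outcomes would make the value at the
    smaller one both zero and a successor. *)
Lemma eval_functional g e x y z : eval g e x y -> eval g e x z -> y = z.
Proof.
move=> ev; elim: ev z => {e x y}.
- by move=> x z h; inversion h.
- by move=> x z h; inversion h.
- by move=> x z h; inversion h.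
- by move=> x z h; inversion h.
- by move=> x z h; inversion h.
- by move=> f h x y z _ IHf _ IHh z' H; inversion H; subst; rewrite (IHf y0) // (IHh z0).
- by move=> f h x y z _ IHh _ IHf z' H; inversion H; subst; apply: IHf; rewrite (IHh y0).
- move=> f h x a y ex _ IHf z H; inversion H; subst; last by congruence.
  by apply: IHf; congruence.
- move=> f h x a n z y ex _ IHz _ IHy z' H; inversion H; subst; first by congruence.
  have [? ?] : a0 = a /\ n0 = n by split; congruence.
  by subst; apply: IHy; rewrite (IHz z0).
- move=> f x n k _ IH0 _ IHm z H; inversion H as [| | | | | | | | |? ? ? k' H0 Hk]; subst.
  case: (ltngtP n z) => // lt; first by have := IH0 _ (Hk _ lt).
  by have := IHm _ lt _ H0.
Qed.

Lemma nunpairS n : nunpair n.+1 =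
  if (nunpair n).1 is a.+1 then (a, (nunpair n).2.+1) else ((nunpair n).2.+1, 0).
Proof. by rewrite /=; case: (nunpair n) => [[|a] b]. Qed.

Lemma npairS a b : npair a b.+1 = (npair a.+1 b).+1.
Proof.
by rewrite /npair addSn !addnS.
Qed.

Lemma npair_diag b : npair b.+1 0 = (npair 0 b).+1.
Proof.
rewrite /npair addn0 add0n addn0.
have -> : (b.+1 * b.+2 = b * b.+1 + b.+1 * 2)%N by lia.
by rewrite divnDMl // addnS.
Qed.

(** [nunpair] walks along the antidiagonals one step at a time, hence the induction on the diagonal
    [a + b] and, within it, on [b]. *)
Lemma npairK a b : nunpair (npair a b) = (a, b).
Proof.
have [s] : {s | a + b = s} by exists (a + b).
elim: s a b => [|s IHs].
  by case=> [|a] [|b].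
move=> a b; elim: b a => [|b IHb] a.
  rewrite addn0 => ->; rewrite npair_diag nunpairS.
  by rewrite IHs.
by move=> eab; rewrite npairS nunpairS IHb //; lia.
Qed.

(** The codes are those of the [countType] structures, the same ones that [runs], [codesVecs] and
    [codesMx] refer to. *)
Definition computable (A B : countType) (f : A -> B) :=
  exists e, forall a, eval noOracle e (pickle a) (pickle (f a)).

Lemma nunpairK x : npair (nunpair x).1 (nunpair x).2 = x.
Proof.
elim: x => // x IH; rewrite nunpairS -[in RHS]IH.
by case: (nunpair x) => [[|a] b] /=; rewrite ?npairS ?npair_diag.
Qed.

(** * Computable functions on natural numbers *)

Definition comp1 (f : nat -> nat) := exists e, forall x, eval noOracle e x (f x).

Lemma comp1_ext f g : f =1 g -> comp1 f -> comp1 g.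
Proof. by move=> fg [e he]; exists e => x; rewrite -fg. Qed.

Lemma comp1_succ : comp1 succn.
Proof. by exists pSucc => x; constructor. Qed.
Lemma comp1_fst : comp1 (fun x => (nunpair x).1).
Proof. by exists pFst => x; constructor. Qed.
Lemma comp1_snd : comp1 (fun x => (nunpair x).2).
Proof. by exists pSnd => x; constructor. Qed.

Lemma comp1_comp f g : comp1 f -> comp1 g -> comp1 (fun x => f (g x)).
Proof.
by move=> [e he] [d hd]; exists (pComp e d) => x; apply: ev_comp (hd x) (he _).
Qed.

Lemma comp1_pair f g : comp1 f -> comp1 g -> comp1 (fun x => npair (f x) (g x)).
Proof. by move=> [e he] [d hd]; exists (pPair e d) => x; apply: ev_pair. Qed.

(** There is no identity instruction; unpairing and pairing again replaces it. *)
Lemma comp1_id : comp1 id.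
Proof.
exists (pPair pFst pSnd) => x; rewrite -[X in eval _ _ _ X]nunpairK.
by apply: ev_pair; constructor.
Qed.

Lemma comp1_const n : comp1 (fun=> n).
Proof.
elim: n => [|n IH]; first by exists pZero => x; constructor.
exact: comp1_comp comp1_succ IH.
Qed.

Lemma comp1_rec f h n : comp1 f ->
  comp1 (fun p => h (nunpair p).1 (nunpair (nunpair p).2).1 (nunpair (nunpair p).2).2) ->
  comp1 n -> comp1 (fun x => nat_rec (fun=> nat) (f x) (h x) (n x)).
Proof.
move=> [ef hf] [eh hh] cn.
have [d hd] := comp1_pair comp1_id cn.
exists (pComp (pPrec ef eh) d) => x; apply: ev_comp (hd x) _.
elim: (n x) => [|k IH] /=; first by apply: ev_prec0 (npairK _ _) (hf _).
apply: ev_precS (npairK _ _) IH _.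
by have := hh (npair x (npair k (nat_rec (fun=> nat) (f x) (h x) k))); rewrite !npairK.
Qed.

(** [pMin] looks for a zero, hence the negated predicate. *)
Lemma comp1_min (P : nat -> pred nat) (H : forall x, exists n, P x n) :
  comp1 (fun p => ~~ P (nunpair p).1 (nunpair p).2) ->
  comp1 (fun x => ex_minn (H x)).
Proof.
move=> [e he]; exists (pMin e) => x.
have hx n : eval noOracle e (npair x n) (~~ P x n) by have := he (npair x n); rewrite npairK.
case: ex_minnP => m Pm mmin; apply: (@ev_min _ _ _ _ (fun=> 0)).
  by have := hx m; rewrite Pm.
move=> k ltk; have := hx k; case: (boolP (P x k)) => // /mmin.
by rewrite leqNgt ltk.
Qed.

Lemma comp1_pred f : comp1 f -> comp1 (fun x => (f x).-1).
Proof.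
move=> cf; pose g x := nat_rec (fun=> nat) 0 (fun n _ => n) (f x).
apply: (@comp1_ext g); first by move=> x; rewrite /g; case: (f x).
apply: (@comp1_rec (fun=> 0) (fun _ n _ => n)) cf; first exact: comp1_const.
exact: comp1_comp comp1_fst comp1_snd.
Qed.

Definition comp1_z : comp1 (fun p => (nunpair (nunpair p).2).2) :=
  comp1_comp comp1_snd comp1_snd.
Lemma comp1_add f g : comp1 f -> comp1 g -> comp1 (fun x => f x + g x).
Proof.
move=> cf cg; pose a x := nat_rec (fun=> nat) (f x) (fun _ => succn) (g x).
apply: (@comp1_ext a).
  by move=> x; rewrite /a; elim: (g x) => [|n IH] /=; rewrite ?addn0 // addnS IH.
apply: (@comp1_rec f (fun _ _ z => z.+1)) => //.
exact: comp1_comp comp1_succ comp1_z.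
Qed.

Lemma comp1_sub f g : comp1 f -> comp1 g -> comp1 (fun x => f x - g x).
Proof.
move=> cf cg; pose a x := nat_rec (fun=> nat) (f x) (fun _ => predn) (g x).
apply: (@comp1_ext a).
  by move=> x; rewrite /a; elim: (g x) => [|n IH] /=; rewrite ?subn0 // subnS IH.
by apply: (@comp1_rec f (fun _ _ z => z.-1)) => //; apply: comp1_pred comp1_z.
Qed.

Lemma comp1_mul f g : comp1 f -> comp1 g -> comp1 (fun x => f x * g x).
Proof.
move=> cf cg; pose a x := nat_rec (fun=> nat) 0 (fun _ z => f x + z) (g x).
apply: (@comp1_ext a).
  by move=> x; rewrite /a; elim: (g x) => [|n IH] /=; rewrite ?muln0 // mulnS IH.
apply: (@comp1_rec (fun=> 0) (fun x _ z => f x + z)) => //; first exact: comp1_const.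
exact: comp1_add (comp1_comp cf comp1_fst) comp1_z.
Qed.

Lemma comp1_exp f g : comp1 f -> comp1 g -> comp1 (fun x => f x ^ g x).
Proof.
move=> cf cg; pose a x := nat_rec (fun=> nat) 1 (fun _ z => f x * z) (g x).
apply: (@comp1_ext a).
  by move=> x; rewrite /a; elim: (g x) => [|n IH] //=; rewrite expnS IH.
apply: (@comp1_rec (fun=> 1) (fun x _ z => f x * z)) => //; first exact: comp1_const.
exact: comp1_mul (comp1_comp cf comp1_fst) comp1_z.
Qed.

Lemma comp1_leq f g : comp1 f -> comp1 g -> comp1 (fun x => f x <= g x).
Proof.
move=> cf cg; apply: (@comp1_ext (fun x => 1 - (f x - g x))).
  by move=> x; rewrite /leq; case: (f x - g x) => [|n].
exact: comp1_sub (comp1_const 1) (comp1_sub cf cg).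
Qed.

Lemma comp1_neg (f : nat -> bool) : comp1 f -> comp1 (fun x => ~~ f x).
Proof.
move=> cf; apply: (@comp1_ext (fun x => 1 - f x)); first by move=> x; case: (f x).
exact: comp1_sub (comp1_const 1) cf.
Qed.

Lemma comp1_div f g : (forall x, 0 < g x) -> comp1 f -> comp1 g ->
  comp1 (fun x => f x %/ g x).
Proof.
move=> g0 cf cg; have H x : exists n, f x < n.+1 * g x.
  by exists (f x %/ g x); rewrite -ltn_divLR.
apply: (@comp1_ext (fun x => ex_minn (H x))) => [x|].
  case: ex_minnP => m; rewrite -ltn_divLR // ltnS => lem mmin.
  by apply/eqP; rewrite eqn_leq lem andbT mmin // -ltn_divLR.
apply: comp1_min; apply: comp1_neg; apply: comp1_leq.
  exact: comp1_comp comp1_succ (comp1_comp cf comp1_fst).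
apply: comp1_mul (comp1_comp comp1_succ comp1_snd) (comp1_comp cg comp1_fst).
Qed.

Lemma comp1_odd f : comp1 f -> comp1 (fun x => odd (f x)).
Proof.
move=> cf; apply: (@comp1_ext (fun x => f x - f x %/ 2 * 2)) => [x|].
  by rewrite divn2 muln2 -{1}(odd_double_half (f x)) addnK.
apply: (comp1_sub cf (comp1_mul _ (comp1_const 2))).
exact: comp1_div cf (comp1_const 2).
Qed.

(** * List codes as numbers *)

Definition hdn x := head 0 (CodeSeq.decode x).
Definition tln x := CodeSeq.code (behead (CodeSeq.decode x)).
(** The code of a nonempty list is [2^x (2y + 1)], and 0 codes the empty list. So the head is the
    2-adic valuation of the code. *)
Definition consn x y := 2 ^ x * y.*2.+1.

Lemma consnE x y : consn x y = CodeSeq.code (x :: CodeSeq.decode y).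
Proof. by rewrite /= CodeSeq.decodeK. Qed.
Lemma hdn_cons x y : hdn (consn x y) = x.
Proof. by rewrite /hdn consnE CodeSeq.codeK. Qed.
Lemma tln_cons x y : tln (consn x y) = y.
Proof. by rewrite /tln consnE CodeSeq.codeK /= CodeSeq.decodeK. Qed.

Lemma consnP x : x = 0 \/ x = consn (hdn x) (tln x).
Proof.
rewrite -(CodeSeq.decodeK x); case: (CodeSeq.decode x) => [|a s]; [by left|right].
by rewrite -[CodeSeq.code _]/(consn a (CodeSeq.code s)) hdn_cons tln_cons.
Qed.

(** Searches for the 2-adic valuation; the disjunct [x <= 0] makes the search stop on the empty list
    too. *)
Lemma comp1_hdn : comp1 hdn.
Proof.
have div x n : (consn x n) %/ 2 ^ x = n.*2.+1 by rewrite /consn mulKn ?expn_gt0.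
have H x : exists n, (x <= 0) || odd (x %/ 2 ^ n).
  case: (consnP x) => [->|->]; first by exists 0.
  by exists (hdn x); rewrite div /= odd_double orbT.
apply: (@comp1_ext (fun x => ex_minn (H x))) => [x|].
  case: ex_minnP => m; case: (consnP x) => [->|->].
    by move=> _ /(_ 0 isT); rewrite leqn0 => /eqP.
  set a := hdn x; set b := tln x; rewrite hdn_cons.
  have -> : consn a b <= 0 = false.
    by apply: negbTE; rewrite -ltnNge /consn muln_gt0 expn_gt0.
  rewrite /= => om /(_ a); rewrite div /= odd_double => /(_ isT) lema.
  case: (ltngtP m a) lema => // ltma _; move: om.
  rewrite /consn -(subnKC ltma) addSnnS expnD -mulnA mulKn ?expn_gt0 //.
  by rewrite expnS -mulnA mul2n odd_double.
apply: comp1_min.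
apply: comp1_neg.
pose Q p := (nunpair p).1 %/ 2 ^ (nunpair p).2.
apply: (@comp1_ext (fun p => 0 < ((nunpair p).1 <= 0) + odd (Q p))) => [p|].
  by rewrite -/(Q p); case: (_ <= 0); case: (odd _).
have cQ : comp1 Q.
  apply: comp1_div comp1_fst (comp1_exp (comp1_const 2) comp1_snd) => x.
  by rewrite expn_gt0.
apply: comp1_leq (comp1_const 1) (comp1_add _ (comp1_odd cQ)).
exact: comp1_leq comp1_fst (comp1_const 0).
Qed.

Lemma comp1_tln : comp1 tln.
Proof.
apply: (@comp1_ext (fun x => ((x %/ 2 ^ hdn x).-1 %/ 2))) => [x|].
  case: (consnP x) => [->|->]; first by [].
  by rewrite hdn_cons tln_cons /consn mulKn ?expn_gt0 //= divn2 doubleK.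
apply: comp1_div (comp1_const 2) => //; apply: comp1_pred.
apply: comp1_div (comp1_exp (comp1_const 2) comp1_hdn); last exact: comp1_id.
by move=> x; rewrite expn_gt0.
Qed.

Lemma comp1_cons f g : comp1 f -> comp1 g -> comp1 (fun x => consn (f x) (g x)).
Proof.
move=> cf cg; apply: (@comp1_ext (fun x => 2 ^ f x * (g x * 2).+1)) => [x|].
  by rewrite /consn muln2.
apply: comp1_mul (comp1_exp (comp1_const 2) cf) _.
exact: comp1_comp comp1_succ (comp1_mul cg (comp1_const 2)).
Qed.

(** * Codes of pairs, integers and rationals *)

Section PickleE.
Lemma pickle_nat (n : nat) : pickle n = n. Proof. by []. Qed.
Lemma pickle_pair (A B : countType) (a : A) (b : B) :
  pickle (a, b) = consn (pickle a) (consn (pickle b) 0).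
Proof. by []. Qed.
Lemma pickle_cons (A : countType) (a : A) s : pickle (a :: s) = consn (pickle a) (pickle s).
Proof. by []. Qed.
(** Integers are coded through a sum of two copies of [nat], which is coded as a pair of options,
    and an option as a list of length at most one. *)
Lemma pickle_posz n : pickle (Posz n) = consn (consn n 0) (consn 0 0). Proof. by []. Qed.
Lemma pickle_negz n : pickle (Negz n) = consn 0 (consn (consn n 0) 0). Proof. by []. Qed.
Lemma pickle_rat (q : rat) : pickle q = pickle (valq q). Proof. by []. Qed.
Lemma unpickle_pair (A B : countType) k : (unpickle k : option (A * B)) =
   if CodeSeq.decode k is [:: a; b] then
     obind (fun x : A => omap (fun y : B => (x, y)) (unpickle b)) (unpickle a) else None.
Proof.
transitivity (omap (@pair_of_tag A B) (@unpickle_tagged A (fun=> B) k)); first by [].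
rewrite /unpickle_tagged; case: (CodeSeq.decode k) => [|a [|b []]] //=.
by case: (unpickle a : option A) => //= x; case: (unpickle b : option B).
Qed.
Lemma unpickle_seqE (A : countType) k :
  (unpickle k : option (seq A)) = Some (pmap unpickle (CodeSeq.decode k)).
Proof. by []. Qed.
Lemma unpickle_rat k : (unpickle k : option rat) = obind insub (unpickle k : option (int * int)).
Proof. by []. Qed.
Lemma unpickle_int k : (unpickle k : option int) =
  if CodeSeq.decode k is [:: a; b] then 
    if CodeSeq.decode b is y :: _ then Some (Negz y) else
    if CodeSeq.decode a is x :: _ then Some (Posz x) else None
  else None.
Proof.
transitivity (omap int_of_natsum (obind (@sum_of_opair nat nat) (unpickle k))); first by [].
rewrite unpickle_pair.
case: (CodeSeq.decode k) => [|a [|b []]] //.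
have E c : (unpickle c : option (option nat)) = Some (ohead (CodeSeq.decode c)).
  transitivity (omap (@ohead nat) (Some (pmap some (CodeSeq.decode c)))); first by [].
  by rewrite /=; elim: (CodeSeq.decode c).
by rewrite !E /=; case: (CodeSeq.decode b); case: (CodeSeq.decode a).
Qed.
End PickleE.

(** * Computable functions between countable types *)

Section TypedComputability.
Variables A : countType.
Implicit Types B C D T : countType.

Lemma computable_ext B (f g : A -> B) : f =1 g -> computable f -> computable g.
Proof. by move=> fg [e he]; exists e => x; rewrite -fg. Qed.

Lemma computable_id : computable (@id A).
Proof. by have [e he] := comp1_id; exists e => a. Qed.

Lemma computable_const B (b : B) : computable (fun _ : A => b).
Proof. by have [e he] := comp1_const (pickle b); exists e => a. Qed.

Lemma computable_comp B C (f : B -> C) (g : A -> B) :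
  computable f -> computable g -> computable (fun a => f (g a)).
Proof.
by move=> [e he] [d hd]; exists (pComp e d) => a; apply: ev_comp (hd a) (he _).
Qed.

Lemma computable_code B C (h : nat -> nat) (f : A -> B) (g : A -> C) : comp1 h ->
  (forall a, pickle (g a) = h (pickle (f a))) -> computable f -> computable g.
Proof.
move=> [e he] gE [d hd]; exists (pComp e d) => a.
by rewrite gE; apply: ev_comp (hd a) (he _).
Qed.

Lemma computable_code2 B C D (h : nat -> nat -> nat) (f : A -> B) (g : A -> C) (k : A -> D) :
  comp1 (fun x => h (nunpair x).1 (nunpair x).2) ->
  (forall a, pickle (k a) = h (pickle (f a)) (pickle (g a))) ->
  computable f -> computable g -> computable k.
Proof.
move=> [e he] kE [d hd] [c hc]; exists (pComp e (pPair d c)) => a.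
rewrite kE; apply: ev_comp (ev_pair (hd a) (hc a)) _.
by have := he (npair (pickle (f a)) (pickle (g a))); rewrite npairK.
Qed.

Lemma computable_pair B C (f : A -> B) (g : A -> C) :
  computable f -> computable g -> computable (fun a => (f a, g a)).
Proof.
apply: (@computable_code2 _ _ _ (fun x y => consn x (consn y 0))) => // {f g}.
exact: comp1_cons comp1_fst (comp1_cons comp1_snd (comp1_const 0)).
Qed.

Lemma computable_fst B C (f : A -> B * C) :
  computable f -> computable (fun a => (f a).1).
Proof.
apply: (computable_code comp1_hdn) => a; case: (f a) => b c.
by rewrite pickle_pair hdn_cons.
Qed.

Lemma computable_snd B C (f : A -> B * C) :
  computable f -> computable (fun a => (f a).2).
Proof.
apply: (computable_code (comp1_comp comp1_hdn comp1_tln)) => a; case: (f a) => b c.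
by rewrite pickle_pair tln_cons hdn_cons.
Qed.

Lemma computable_rec B (f : A -> B) (h : A -> nat -> B -> B) (n : A -> nat) :
  computable f -> computable (fun p : A * (nat * B) => h p.1 p.2.1 p.2.2) ->
  computable n -> computable (fun a => nat_rect (fun=> B) (f a) (h a) (n a)).
Proof.
move=> [ef hf] [eh hh] [en hn]; have [ei hi] := comp1_id.
(* [pPrec] passes its arguments as Cantor pairs, whereas typed pairs are coded as two-element lists;
   [ec] translates. *)
have [ec hc] : comp1 (fun p => consn (nunpair p).1 (consn
     (consn (nunpair (nunpair p).2).1 (consn (nunpair (nunpair p).2).2 0)) 0)).
  apply: comp1_cons comp1_fst _; apply: comp1_cons (comp1_const 0).
  apply: comp1_cons (comp1_comp comp1_fst comp1_snd) _.
  exact: comp1_cons comp1_z (comp1_const 0).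
exists (pComp (pPrec ef (pComp eh ec)) (pPair ei en)) => a.
apply: ev_comp (ev_pair (hi _) (hn a)) _.
rewrite [pickle (n a)]pickle_nat.
elim: (n a) => [|k IH] /=; first by apply: ev_prec0 (npairK _ _) (hf _).
apply: ev_precS (npairK _ _) IH _; set z := nat_rect _ _ _ _.
apply: ev_comp (hc _) _; rewrite !npairK /=.
exact: hh (a, (k, z)).
Qed.

(** A conditional is a recursion of length zero or one. *)
Lemma computable_if B (b : A -> bool) (f g : A -> B) :
  computable b -> computable f -> computable g ->
  computable (fun a => if b a then f a else g a).
Proof.
move=> cb cf cg.
apply: (@computable_ext _ (fun a => nat_rect (fun=> B) (g a) (fun _ _ => f a) (b a))).
  by move=> a; case: (b a).
apply: computable_rec cg _ _; last exact: (computable_code comp1_id _ cb).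
by case: cf => e he; have [d hd] := comp1_hdn; exists (pComp e d) => -[a p];
  apply: ev_comp (hd _) _; rewrite pickle_pair hdn_cons.
Qed.

Lemma computable_min (P : A -> pred nat) (H : forall a, exists n, P a n) :
  computable (fun p : A * nat => P p.1 p.2) -> computable (fun a => ex_minn (H a)).
Proof.
move=> [e he]; have [en hn] := comp1_sub (comp1_const 1) comp1_id.
have [ec hc] := comp1_cons comp1_fst (comp1_cons comp1_snd (comp1_const 0)).
exists (pMin (pComp en (pComp e ec))) => a.
have hx n : eval noOracle (pComp en (pComp e ec)) (npair (pickle a) n) (~~ P a n).
  apply: (@ev_comp _ _ _ _ (P a n)); last by have := hn (P a n); case: (P a n).
  apply: ev_comp (hc _) _; rewrite !npairK; exact: (he (a, n)).
rewrite [pickle (ex_minn _)]pickle_nat.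
case: ex_minnP => m Pm mmin; apply: (@ev_min _ _ _ _ (fun=> 0)).
  by have := hx m; rewrite Pm.
move=> k ltk; have := hx k; case: (boolP (P a k)) => // /mmin.
by rewrite leqNgt ltk.
Qed.

Lemma computable_pickle B (f : A -> B) : computable f -> computable (fun a => pickle (f a)).
Proof. exact: (computable_code comp1_id). Qed.

Section Nat.
Variables f g : A -> nat.
Hypotheses (cf : computable f) (cg : computable g).

Lemma computable_succ : computable (fun a => (f a).+1).
Proof. exact: (computable_code comp1_succ _ cf). Qed.
Lemma computable_pred : computable (fun a => (f a).-1).
Proof. exact: (computable_code (comp1_pred comp1_id) _ cf). Qed.
Lemma computable_addn : computable (fun a => f a + g a).
Proof. exact: (computable_code2 (comp1_add comp1_fst comp1_snd) _ cf cg). Qed.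
Lemma computable_subn : computable (fun a => f a - g a).
Proof. exact: (computable_code2 (comp1_sub comp1_fst comp1_snd) _ cf cg). Qed.
Lemma computable_muln : computable (fun a => f a * g a).
Proof. exact: (computable_code2 (comp1_mul comp1_fst comp1_snd) _ cf cg). Qed.
Lemma computable_expn : computable (fun a => f a ^ g a).
Proof. exact: (computable_code2 (comp1_exp comp1_fst comp1_snd) _ cf cg). Qed.
Lemma computable_leq : computable (fun a => f a <= g a).
Proof. exact: (computable_code2 (h := fun x y => nat_of_bool (x <= y)) (comp1_leq comp1_fst comp1_snd) _ cf cg). Qed.
Lemma computable_odd : computable (fun a => odd (f a)).
Proof. exact: (computable_code (h := fun x => nat_of_bool (odd x)) (comp1_odd comp1_id) _ cf). Qed.
End Nat.

Section Bool.
Variables f g : A -> bool.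
Hypotheses (cf : computable f) (cg : computable g).
Lemma computable_negb : computable (fun a => ~~ f a).
Proof.
by apply: (computable_code (comp1_sub (comp1_const 1) comp1_id) _ cf) => a; case: (f a).
Qed.
Lemma computable_andb : computable (fun a => f a && g a).
Proof. exact: (computable_if cf cg (computable_const false)). Qed.
Lemma computable_orb : computable (fun a => f a || g a).
Proof. exact: (computable_if cf (computable_const true) cg). Qed.
Lemma computable_nat_of_bool : computable (fun a => nat_of_bool (f a)).
Proof. exact: (computable_code comp1_id _ cf). Qed.
End Bool.

(** Pickling is injective, so equality can be tested on codes. *)
Lemma computable_eq B (f g : A -> B) :
  computable f -> computable g -> computable (fun a => f a == g a).
Proof.
move=> /computable_pickle cf /computable_pickle cg.
apply: (computable_ext _ (computable_andb (computable_leq cf cg) (computable_leq cg cf))).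
by move=> a; rewrite -eqn_leq (inj_eq (pcan_inj pickleK)).
Qed.

Lemma computable_divn (f g : A -> nat) :
  computable f -> computable g -> computable (fun a => f a %/ g a).
Proof.
move=> cf cg.
apply: (@computable_ext _ (fun a => if g a == 0 then 0 else f a %/ (g a).-1.+1)).
  by move=> a; case: (g a).
apply: computable_if; [exact: computable_eq (computable_const 0)|exact: computable_const|].
apply: (computable_code2 (h := fun x y => x %/ y.-1.+1) _ _ cf cg) => //.
by apply: comp1_div comp1_fst (comp1_comp comp1_succ (comp1_pred comp1_snd)).
Qed.

Section Seq.
Variable T : countType.

Lemma computable_cons (f : A -> T) (g : A -> seq T) :
  computable f -> computable g -> computable (fun a => f a :: g a).
Proof. exact: (computable_code2 (comp1_cons comp1_fst comp1_snd)). Qed.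

Lemma computable_behead (f : A -> seq T) :
  computable f -> computable (fun a => behead (f a)).
Proof.
apply: (computable_code comp1_tln) => a; case: (f a) => // x s.
by rewrite pickle_cons tln_cons.
Qed.

(** Only the empty list has code 0, so the case distinction is a recursion of length at most one on
    the positivity of the code. *)
Lemma computable_case_seq B (f : A -> seq T) (b : A -> B) (G : A -> T -> seq T -> B) :
  computable f -> computable b ->
  computable (fun p : A * (T * seq T) => G p.1 p.2.1 p.2.2) ->
  computable (fun a => if f a is x :: s then G a x s else b a).
Proof.
move=> [ef hf] [eb hb] [eG hG].
have [ei hi] := comp1_id.
have [ez hz] : comp1 (fun x => 0 < x) by apply: comp1_leq (comp1_const 1) comp1_id.
have [ec hc] : comp1 (fun p => consn (nunpair (nunpair p).1).1 (consn
     (consn (hdn (nunpair (nunpair p).1).2) (consn (tln (nunpair (nunpair p).1).2) 0)) 0)).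
  apply: comp1_cons (comp1_comp comp1_fst comp1_fst) _; apply: comp1_cons (comp1_const 0).
  have c12 := comp1_comp comp1_snd comp1_fst.
  apply: comp1_cons (comp1_comp comp1_hdn c12) _.
  exact: comp1_cons (comp1_comp comp1_tln c12) (comp1_const 0).
exists (pComp (pPrec (pComp eb pFst) (pComp eG ec)) (pPair (pPair ei ef) (pComp ez ef))) => a.
apply: ev_comp.
  exact: ev_pair (ev_pair (hi _) (hf a)) (ev_comp (hf a) (hz _)).
have base y : eval noOracle (pComp eb pFst) (npair (pickle a) y) (pickle (b a)).
  by apply: ev_comp (hb a); have := ev_fst noOracle (npair (pickle a) y); rewrite npairK.
case: (f a) => [|x s]; first exact: ev_prec0 (npairK _ _) (base _).
have -> : (0 < pickle (x :: s)) = true by rewrite pickle_cons /consn muln_gt0 expn_gt0.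
apply: ev_precS (npairK _ _) _ _; first exact: ev_prec0 (npairK _ _) (base _).
apply: ev_comp (hc _) _; rewrite !npairK [pickle (x :: s)]pickle_cons hdn_cons tln_cons.
exact: (hG (a, (x, s))).
Qed.
End Seq.
End TypedComputability.

(** Provides a computable bound on the number of iterations of a fold. *)
Lemma size_le_pickle (T : countType) (s : seq T) : size s <= pickle s.
Proof.
elim: s => // x s IH; rewrite pickle_cons /= /consn.
apply: leq_trans (_ : (pickle s).*2.+1 <= _); first by rewrite ltnS -addnn (leq_trans IH) ?leq_addr.
by rewrite leq_pmull ?expn_gt0.
Qed.

Section Folds.
Variable A : countType.

(** The state consists of the remaining list and the accumulator. The step idles on the empty list,
    so that iterating it more often than the length, namely [pickle (l a)] times, does no harm. *)
Lemma computable_foldl (T B : countType) (F : A -> B -> T -> B) (b : A -> B) (l : A -> seq T) :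
  computable (fun p : A * (B * T) => F p.1 p.2.1 p.2.2) -> computable b -> computable l ->
  computable (fun a => foldl (F a) (b a) (l a)).
Proof.
move=> cF cb cl.
pose step a (st : seq T * B) := if st.1 is x :: s then (s, F a st.2 x) else st.
pose it a n := nat_rect (fun=> (seq T * B)%type) (l a, b a) (fun _ => step a) n.
apply: (@computable_ext _ _ (fun a => (it a (pickle (l a))).2)) => [a|].
  have E n s c : size s <= n ->
      (nat_rect (fun=> (seq T * B)%type) (s, c) (fun _ => step a) n) = ([::], foldl (F a) c s).
    have itS m st : nat_rect (fun=> (seq T * B)%type) st (fun _ => step a) m.+1 =
        nat_rect (fun=> (seq T * B)%type) (step a st) (fun _ => step a) m.
      by elim: m => //= m ->.
    elim: n s c => [|n IH] [|x s] c //.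
      by rewrite itS /= /step /= IH.
    by rewrite itS /= ltnS /step /= => /IH ->.
  by rewrite /it E ?size_le_pickle.
apply: computable_snd; apply: (@computable_rec _ _ _ (fun a _ => step a)).
- exact: computable_pair.
- rewrite /step; apply: (@computable_case_seq _ _ _ (fun p : A * (nat * (seq T * B)) => p.2.2.1)
     (fun p => p.2.2) (fun p x s => (s, F p.1 p.2.2.2 x))).
  + apply: computable_fst; do 2 apply: computable_snd; exact: computable_id.
  + do 2 apply: computable_snd; exact: computable_id.
  + apply: computable_pair.
      by do 2 apply: computable_snd; exact: computable_id.
    apply: (@computable_comp _ _ _ (fun p : A * (B * T) => F p.1 p.2.1 p.2.2)
      (fun p : (A * (nat * (seq T * B))) * (T * seq T) => (p.1.1, (p.1.2.2.2, p.2.1)))) => //.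
    apply: computable_pair; first by do 2 apply: computable_fst; exact: computable_id.
    apply: computable_pair; last by apply: computable_fst; apply: computable_snd; exact: computable_id.
    by do 3 apply: computable_snd; apply: computable_fst; exact: computable_id.
- exact: computable_pickle.
Qed.

Lemma computable_rev (T : countType) (l : A -> seq T) :
  computable l -> computable (fun a => rev (l a)).
Proof.
move=> cl; apply: (@computable_ext _ _ (fun a => foldl (fun s x => x :: s) [::] (l a))) => [a|].
  by rewrite -[l a in LHS]revK foldl_rev; elim: (rev (l a)) => //= x s ->.
apply: (@computable_foldl _ _ (fun _ s x => x :: s)) => //; last exact: computable_const.
by apply: computable_cons; [apply: computable_snd|apply: computable_fst];
  apply: computable_snd; exact: computable_id.
Qed.

Lemma computable_foldr (T B : countType) (F : A -> T -> B -> B) (b : A -> B) (l : A -> seq T) :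
  computable (fun p : A * (T * B) => F p.1 p.2.1 p.2.2) -> computable b -> computable l ->
  computable (fun a => foldr (F a) (b a) (l a)).
Proof.
move=> cF cb cl.
apply: (@computable_ext _ _ (fun a => foldl (fun z x => F a x z) (b a) (rev (l a)))) => [a|].
  by rewrite foldl_rev.
apply: (@computable_foldl _ _ (fun a z x => F a x z)) => //; last exact: computable_rev.
apply: (@computable_comp _ _ _ (fun p : A * (T * B) => F p.1 p.2.1 p.2.2)
      (fun p : A * (B * T) => (p.1, (p.2.2, p.2.1)))) => //.
apply: computable_pair; first by apply: computable_fst; exact: computable_id.
by apply: computable_pair; [apply: computable_snd|apply: computable_fst];
  apply: computable_snd; exact: computable_id.
Qed.
End Folds.

(** A hook for [comp_step], redefined each time further operations are known to be computable. *)
Ltac comp_user := fail.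
Ltac comp_step :=
  cbn beta;
  lazymatch goal with
  | |- computable (fun a => a) => exact: computable_id
  | |- computable fst => apply: (@computable_fst _ _ _ id)
  | |- computable snd => apply: (@computable_snd _ _ _ id)
  | |- computable id => exact: computable_id
  | |- computable (fun _ => ?c) => exact: computable_const
  | |- computable (fun a => (@?f a, @?g a)) => apply: (@computable_pair _ _ _ f g)
  | |- computable (fun a => fst (@?f a)) => apply: (@computable_fst _ _ _ f)
  | |- computable (fun a => snd (@?f a)) => apply: (@computable_snd _ _ _ f)
  | |- computable (fun a => (@?f a) :: (@?g a)) => apply: (@computable_cons _ _ f g)
  | |- computable (fun a => behead (@?f a)) => apply: (@computable_behead _ _ f)
  | |- computable (fun a => rev (@?f a)) => apply: (@computable_rev _ _ f)
  | |- computable (fun a => S (@?f a)) => apply: (@computable_succ _ f)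
  | |- computable (fun a => predn (@?f a)) => apply: (@computable_pred _ f)
  | |- computable (fun a => addn (@?f a) (@?g a)) => apply: (@computable_addn _ f g)
  | |- computable (fun a => subn (@?f a) (@?g a)) => apply: (@computable_subn _ f g)
  | |- computable (fun a => muln (@?f a) (@?g a)) => apply: (@computable_muln _ f g)
  | |- computable (fun a => expn (@?f a) (@?g a)) => apply: (@computable_expn _ f g)
  | |- computable (fun a => divn (@?f a) (@?g a)) => apply: (@computable_divn _ f g)
  | |- computable (fun a => odd (@?f a)) => apply: (@computable_odd _ f)
  | |- computable (fun a => leq (@?f a) (@?g a)) => apply: (@computable_leq _ f g)
  | |- computable (fun a => negb (@?f a)) => apply: (@computable_negb _ f)
  | |- computable (fun a => nat_of_bool (@?f a)) => apply: (@computable_nat_of_bool _ f)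
  | |- computable (fun a => andb (@?f a) (@?g a)) => apply: (@computable_andb _ f g)
  | |- computable (fun a => orb (@?f a) (@?g a)) => apply: (@computable_orb _ f g)
  | |- computable (fun a => (@?f a) == (@?g a)) => apply: (@computable_eq _ _ f g)
  | |- computable (fun a => pickle (@?f a)) => apply: (@computable_pickle _ _ f)
  | |- computable (fun a => @foldr ?T ?B (@?F a) (@?b a) (@?l a)) =>
       apply: (@computable_foldr _ _ _ F b l)
  | |- computable (fun a => @nat_rect _ (@?b a) (@?F a) (@?l a)) =>
       apply: (@computable_rec _ _ b F l)
  | |- computable (fun a => @ex_minn _ (@?H a)) => apply: (@computable_min _ _ H)
  | |- _ => comp_user
  end.
Ltac comp := repeat (first [comp_step | assumption]).

Section ListOps.
Variables A T : countType.

Lemma computable_map (B : countType) (F : A -> T -> B) (l : A -> seq T) :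
  computable (fun p : A * T => F p.1 p.2) -> computable l ->
  computable (fun a => map (F a) (l a)).
Proof.
move=> cF cl.
apply: (@computable_ext _ _ (fun a => foldr (fun x s => F a x :: s) [::] (l a))) => //.
comp; apply: (@computable_comp _ _ _ _ (fun p : A * (T * seq B) => (p.1, p.2.1)) cF).
comp.
Qed.

Lemma computable_all (F : A -> T -> bool) (l : A -> seq T) :
  computable (fun p : A * T => F p.1 p.2) -> computable l ->
  computable (fun a => all (F a) (l a)).
Proof.
move=> cF cl.
apply: (@computable_ext _ _ (fun a => foldr (fun x s => F a x && s) true (l a))) => //.
comp; apply: (@computable_comp _ _ _ _ (fun p : A * (T * bool) => (p.1, p.2.1)) cF).
comp.
Qed.

Lemma computable_size (l : A -> seq T) : computable l -> computable (fun a => size (l a)).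
Proof.
move=> cl.
apply: (@computable_ext _ _ (fun a => foldr (fun _ n => n.+1) 0 (l a))) => //.
comp.
Qed.

Lemma computable_cat (l m : A -> seq T) : computable l -> computable m ->
  computable (fun a => l a ++ m a).
Proof.
move=> cl cm.
apply: (@computable_ext _ _ (fun a => foldr (fun x s => x :: s) (m a) (l a))).
  by move=> a; elim: (l a) => //= x s ->.
comp.
Qed.

Lemma computable_head (x0 : A -> T) (l : A -> seq T) : computable x0 -> computable l ->
  computable (fun a => head (x0 a) (l a)).
Proof.
move=> cx cl; apply: (@computable_case_seq _ _ _ l x0 (fun _ x _ => x)) => //; comp.
Qed.

Lemma computable_nth (x0 : A -> T) (l : A -> seq T) (i : A -> nat) :
  computable x0 -> computable l -> computable i ->
  computable (fun a => nth (x0 a) (l a) (i a)).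
Proof.
move=> cx cl ci.
pose d a := nat_rect (fun=> seq T) (l a) (fun _ s => behead s) (i a).
apply: (@computable_ext _ _ (fun a => head (x0 a) (d a))) => [a|].
  suff -> : d a = drop (i a) (l a) by rewrite -nth0 nth_drop addn0.
  rewrite /d; elim: (i a) (l a) => [|n IH] s /=; first by rewrite drop0.
  by rewrite IH; elim: s n {IH} => [|x s IH] [|n] //=; rewrite ?drop0.
by apply: computable_head => //; rewrite /d; comp.
Qed.

Lemma computable_nseq (n : A -> nat) (x : A -> T) : computable n -> computable x ->
  computable (fun a => nseq (n a) (x a)).
Proof.
move=> cn cx.
apply: (@computable_ext _ _ (fun a => nat_rect (fun=> seq T) [::] (fun _ s => x a :: s) (n a))).
  by move=> a; elim: (n a) => //= k ->.
comp; apply: (@computable_comp _ _ _ x (fun p : A * (nat * seq T) => p.1)) => //; comp.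
Qed.

Lemma computable_iota (m n : A -> nat) : computable m -> computable n ->
  computable (fun a => iota (m a) (n a)).
Proof.
move=> cm cn.
apply: (@computable_ext _ _ (fun a =>
   rev (nat_rect (fun=> seq nat) [::] (fun i s => (m a + i) :: s) (n a)))) => [a|].
  elim: (n a) => // k IH; rewrite -[k.+1 in RHS]addn1 iotaD -IH /=.
  by rewrite rev_cons cats1.
comp; apply: (@computable_comp _ _ _ m (fun p : A * (nat * seq nat) => p.1)) => //; comp.
Qed.
End ListOps.

Ltac comp_lists :=
  lazymatch goal with
  | |- computable (fun a => map (@?F a) (@?l a)) => apply: (@computable_map _ _ _ F l)
  | |- computable (fun a => all (@?F a) (@?l a)) => apply: (@computable_all _ _ F l)
  | |- computable (fun a => size (@?l a)) => apply: (@computable_size _ _ l)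
  | |- computable (fun a => (@?l a) ++ (@?m a)) => apply: (@computable_cat _ _ l m)
  | |- computable (fun a => head (@?x a) (@?m a)) => apply: (@computable_head _ _ x m)
  | |- computable (fun a => nth (@?x a) (@?m a) (@?i a)) => apply: (@computable_nth _ _ x m i)
  | |- computable (fun a => nseq (@?x a) (@?m a)) => apply: (@computable_nseq _ _ x m)
  | |- computable (fun a => iota (@?x a) (@?m a)) => apply: (@computable_iota _ x m)
  end.
Ltac comp_user ::= comp_lists.

(** Minimisation searches upwards, so the largest common divisor is found as [f a + g a - n] with
    [n] least. The starting point [f a + g a] also covers vanishing arguments. *)
Lemma computable_gcdn (A : countType) (f g : A -> nat) :
  computable f -> computable g -> computable (fun a => gcdn (f a) (g a)).
Proof.
move=> cf cg; pose dv d x := x %/ d * d == x.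
have dvE d x : dv d x = (d %| x) by rewrite /dv dvdn_eq.
pose P a n := dv (f a + g a - n) (f a) && dv (f a + g a - n) (g a).
have le_gcd a : gcdn (f a) (g a) <= f a + g a.
  case: (posnP (f a)) => [->|f0]; first by rewrite gcd0n.
  by rewrite (leq_trans (dvdn_leq f0 (dvdn_gcdl _ _))) // leq_addr.
have H a : exists n, P a n.
  exists (f a + g a - gcdn (f a) (g a)); rewrite /P !dvE subKn //.
  by rewrite dvdn_gcdl dvdn_gcdr.
apply: (@computable_ext _ _ (fun a => f a + g a - ex_minn (H a))) => [a|].
  case: ex_minnP => m; rewrite /P !dvE -dvdn_gcd => dm mmin.
  have := mmin (f a + g a - gcdn (f a) (g a)); rewrite !dvE subKn //.
  rewrite -dvdn_gcd dvdnn => /(_ isT) le.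
  have [g0|g0] := posnP (gcdn (f a) (g a)).
    have := gcdn_gt0 (f a) (g a); rewrite g0 ltnn => /esym /norP [].
    by rewrite -!eqn0Ngt => /eqP-> /eqP ->.
  by have := dvdn_leq g0 dm; have := le_gcd a; lia.
comp; rewrite /P /dv; comp.
all: try by apply: (@computable_comp _ _ _ f (fun p : A * nat => p.1)) => //; comp.
all: by apply: (@computable_comp _ _ _ g (fun p : A * nat => p.1)) => //; comp.
Qed.

(** * Integer and rational arithmetic *)

Section IntOps.
Local Open Scope ring_scope.
Variable A : countType.
Implicit Types f g : A -> int.

(** Integer operations are reduced to operations on positive and negative parts, followed by one
    difference. *)
Definition zpos (z : int) : nat := if z is Posz n then n else 0.
Definition zneg (z : int) : nat := if z is Negz n then n.+1 else 0.

Lemma zpos_zneg z : z = (zpos z)%:Z - (zneg z)%:Z.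
Proof. by case: z => n; rewrite ?subr0 // sub0r NegzE. Qed.

Lemma computable_zpos f : computable f -> computable (fun a => zpos (f a)).
Proof.
apply: (computable_code (h := fun z => hdn (hdn z))).
  exact: comp1_comp comp1_hdn comp1_hdn.
by move=> a; case: (f a) => n; rewrite ?pickle_posz ?pickle_negz !hdn_cons.
Qed.

Lemma computable_zneg f : computable f -> computable (fun a => zneg (f a)).
Proof.
move=> cf.
pose h z := hdn (tln z).
have ch : comp1 h by apply: comp1_comp comp1_hdn comp1_tln.
pose k z := (nat_of_bool (0 < h z) * (hdn (h z)).+1)%N.
apply: (computable_code (h := k) _ _ cf).
  apply: comp1_mul; first exact: comp1_leq (comp1_const 1) ch.
  by apply: comp1_comp comp1_succ _; apply: comp1_comp comp1_hdn ch.
move=> a; case: (f a) => n; rewrite /k /h ?pickle_posz ?pickle_negz !(hdn_cons, tln_cons) //.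
by rewrite {1}/consn muln_gt0 expn_gt0 mul1n.
Qed.

Lemma computable_posz (n : A -> nat) : computable n -> computable (fun a => Posz (n a)).
Proof.
apply: (computable_code (h := fun n => consn (consn n 0) (consn 0 0))) => //.
apply: comp1_cons (comp1_cons comp1_id (comp1_const 0)) (comp1_const _).
Qed.

Lemma computable_negz (n : A -> nat) : computable n -> computable (fun a => Negz (n a)).
Proof.
apply: (computable_code (h := fun n => consn 0 (consn (consn n 0) 0))) => //.
apply: comp1_cons (comp1_const _) (comp1_cons (comp1_cons comp1_id (comp1_const 0)) (comp1_const _)).
Qed.

Lemma computable_diffz (m n : A -> nat) : computable m -> computable n ->
  computable (fun a => (m a)%:Z - (n a)%:Z).
Proof.
move=> cm cn.
apply: (@computable_ext _ _ (fun a => if (n a <= m a)%N then Posz (m a - n a)%N else Negz (n a - m a).-1)%N).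
  move=> a; case: leqP => le; first by rewrite -subzn.
  by rewrite NegzE prednK ?subn_gt0 // -subzn ?opprB // ltnW.
apply: computable_if; first by comp.
  by apply: computable_posz; comp.
by apply: computable_negz; comp.
Qed.

Lemma computable_addz f g : computable f -> computable g -> computable (fun a => f a + g a).
Proof.
move=> cf cg; apply: (@computable_ext _ _ (fun a =>
  (zpos (f a) + zpos (g a))%N%:Z - (zneg (f a) + zneg (g a))%N%:Z)).
  by move=> a; rewrite {3}(zpos_zneg (f a)) {3}(zpos_zneg (g a)) !PoszD; lia.
by apply: computable_diffz; apply: computable_addn;
   (apply: computable_zpos || apply: computable_zneg).
Qed.

Lemma computable_oppz f : computable f -> computable (fun a => - f a).
Proof.
move=> cf; apply: (@computable_ext _ _ (fun a => (zneg (f a))%:Z - (zpos (f a))%:Z)).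
  by move=> a; rewrite {3}(zpos_zneg (f a)) opprB.
by apply: computable_diffz; [apply: computable_zneg|apply: computable_zpos].
Qed.

Lemma computable_mulz f g : computable f -> computable g -> computable (fun a => f a * g a).
Proof.
move=> cf cg; apply: (@computable_ext _ _ (fun a =>
  (zpos (f a) * zpos (g a) + zneg (f a) * zneg (g a))%N%:Z
  - (zpos (f a) * zneg (g a) + zneg (f a) * zpos (g a))%N%:Z)).
  move=> a; rewrite [in RHS](zpos_zneg (f a)) [in RHS](zpos_zneg (g a)) !PoszD !PoszM.
  by set x := Posz _; set y := Posz _; set z := Posz _; set t := Posz _; ring.
have ? := computable_zpos cf; have ? := computable_zpos cg.
have ? := computable_zneg cf; have ? := computable_zneg cg.
by apply: computable_diffz; comp.
Qed.

Lemma computable_lez f g : computable f -> computable g -> computable (fun a => f a <= g a).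
Proof.
move=> cf cg; apply: (@computable_ext _ _ (fun a =>
  (zpos (f a) + zneg (g a) <= zpos (g a) + zneg (f a))%N)).
  move=> a; rewrite [in RHS](zpos_zneg (f a)) [in RHS](zpos_zneg (g a)).
  by rewrite lerBlDr addrAC lerBrDr -!PoszD lez_nat.
have ? := computable_zpos cf; have ? := computable_zpos cg.
have ? := computable_zneg cf; have ? := computable_zneg cg.
comp.
Qed.

Lemma computable_absz f : computable f -> computable (fun a => `|f a|%N).
Proof.
move=> cf; apply: (@computable_ext _ _ (fun a => zpos (f a) + zneg (f a))%N).
  by move=> a; case: (f a) => n /=; rewrite ?addn0.
have ? := computable_zpos cf; have ? := computable_zneg cf; comp.
Qed.
End IntOps.

Section RatOps.
Local Open Scope ring_scope.
Variable A : countType.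
Implicit Types f g : A -> rat.

Lemma computable_valq f : computable f -> computable (fun a => valq (f a)).
Proof. exact: (computable_code comp1_id). Qed.

Lemma computable_numq f : computable f -> computable (fun a => numq (f a)).
Proof. by move=> /computable_valq cf; exact: computable_fst cf. Qed.

Lemma computable_denq f : computable f -> computable (fun a => denq (f a)).
Proof. by move=> /computable_valq cf; exact: computable_snd cf. Qed.

(** A rational is coded by its reduced fraction, so every arithmetic operation ends with a division
    by the gcd. One of [zpos] and [zneg] vanishes, hence their sum is the absolute value. *)
Lemma computable_fracq (n : A -> int) (d : A -> nat) : (forall a, (0 < d a)%N) ->
  computable n -> computable d -> computable (fun a => (n a)%:~R / (d a)%:R : rat).
Proof.
move=> d0 cn cd.
pose g a := gcdn (zpos (n a) + zneg (n a)) (d a).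
apply: (computable_code (f := fun a =>
  ((zpos (n a) %/ g a)%N%:Z - (zneg (n a) %/ g a)%N%:Z, (d a %/ g a)%N%:Z)) comp1_id).
  move=> a; rewrite pickle_rat; congr pickle.
  have -> : (n a)%:~R / (d a)%:R = fracq (n a, (d a)%:Z) by rewrite fracqE /= -pmulrn.
  rewrite -/(val (fracq (n a, (d a)%:Z))) val_fracq /=.
  have -> : (d a)%:Z != 0 by rewrite -lt0n d0.
  rewrite /g; case: (n a) => m /=.
    by rewrite div0n addn0 subr0 expr0z mul1r.
  by rewrite div0n add0n sub0r expr1z mulN1r.
have ? := computable_zpos cn; have ? := computable_zneg cn.
have cg : computable g by apply: computable_gcdn => //; comp.
apply: computable_pair; last by apply: computable_posz; comp.
by apply: computable_diffz; comp.
Qed.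

Lemma computable_denn f : computable f -> computable (fun a => `|denq (f a)|%N).
Proof. by move=> cf; apply/computable_absz/computable_denq. Qed.

Lemma absz_denq_gt0 (q : rat) : (0 < `|denq q|)%N.
Proof. by rewrite absz_gt0 denq_neq0. Qed.

Lemma rat_numden (q : rat) : q = (numq q)%:~R / `|denq q|%N%:R.
Proof. by rewrite -[LHS]divq_num_den -[in LHS]absz_denq -pmulrn. Qed.

Lemma computable_addq f g : computable f -> computable g -> computable (fun a => f a + g a).
Proof.
move=> cf cg; apply: (@computable_ext _ _ (fun a =>
  (numq (f a) * Posz `|denq (g a)| + numq (g a) * Posz `|denq (f a)|)%:~R /
  (`|denq (f a)| * `|denq (g a)|)%N%:R)) => [a|].
  rewrite [in RHS](rat_numden (f a)) [in RHS](rat_numden (g a)) natrM rmorphD /= !rmorphM /= -!pmulrn.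
  have := absz_denq_gt0 (f a); have := absz_denq_gt0 (g a).
  rewrite -(ltr0n rat) -[(0 < `|denq (f a)|)%N](ltr0n rat) => /gt_eqF d1 /gt_eqF d2.
  set x := (numq (f a))%:~R; set y := (numq (g a))%:~R.
  by field; rewrite d1 d2.
have ? := computable_numq cf; have ? := computable_numq cg.
have ? := computable_denn cf; have ? := computable_denn cg.
apply: computable_fracq; first by move=> a; rewrite muln_gt0 !absz_denq_gt0.
  by apply: computable_addz; apply: computable_mulz => //; apply: computable_posz.
by comp.
Qed.

Lemma computable_mulq f g : computable f -> computable g -> computable (fun a => f a * g a).
Proof.
move=> cf cg; apply: (@computable_ext _ _ (fun a =>
  (numq (f a) * numq (g a))%:~R / (`|denq (f a)| * `|denq (g a)|)%N%:R)) => [a|].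
  rewrite [in RHS](rat_numden (f a)) [in RHS](rat_numden (g a)) natrM !rmorphM /=.
  by rewrite mulf_div.
have ? := computable_numq cf; have ? := computable_numq cg.
have ? := computable_denn cf; have ? := computable_denn cg.
apply: computable_fracq; first by move=> a; rewrite muln_gt0 !absz_denq_gt0.
  by apply: computable_mulz.
by comp.
Qed.

Lemma computable_oppq f : computable f -> computable (fun a => - f a).
Proof.
move=> cf; apply: (@computable_ext _ _ (fun a => (- numq (f a))%:~R / `|denq (f a)|%N%:R)) => [a|].
  by rewrite rmorphN /= mulNr -rat_numden.
apply: computable_fracq; first by move=> a; rewrite absz_denq_gt0.
  by apply/computable_oppz/computable_numq.
exact: computable_denn.
Qed.

Lemma computable_natV (n : A -> nat) : computable n -> computable (fun a => (n a)%:R^-1 : rat).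
Proof.
move=> cn; apply: (@computable_ext _ _ (fun a =>
   (if n a == 0 then 0 else 1%N%:Z)%:~R / (n a).-1.+1%:R)) => [a|].
  by case: (n a) => [|m] /=; rewrite ?mul0r ?invr0 ?mul1r // -pmulrn.
apply: computable_fracq => //; last by comp.
by apply: computable_if; comp.
Qed.

Lemma computable_intq (n : A -> int) : computable n -> computable (fun a => (n a)%:~R : rat).
Proof.
move=> cn; apply: (@computable_ext _ _ (fun a => (n a)%:~R / 1%N%:R)) => [a|].
  by rewrite divr1.
by apply: computable_fracq => //; comp.
Qed.

Lemma computable_natq (n : A -> nat) : computable n -> computable (fun a => (n a)%:R : rat).
Proof.
move=> cn; apply: (@computable_ext _ _ (fun a => (Posz (n a))%:~R)) => [a|].
  by rewrite -pmulrn.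
by apply/computable_intq/computable_posz.
Qed.

Lemma computable_leq_rat f g : computable f -> computable g -> computable (fun a => f a <= g a).
Proof.
move=> cf cg; apply: (@computable_ext _ _ (fun a =>
   0 <= numq (g a + - f a))) => [a|]; first by rewrite numq_ge0 subr_ge0.
apply: computable_lez; first exact: computable_const.
by apply: computable_numq; apply: computable_addq => //; apply: computable_oppq.
Qed.

Lemma computable_lt_rat f g : computable f -> computable g -> computable (fun a => f a < g a).
Proof.
move=> cf cg; apply: (@computable_ext _ _ (fun a => ~~ (g a <= f a))) => [a|].
  by rewrite ltNge.
by apply/computable_negb/computable_leq_rat.
Qed.

Lemma computable_normq f : computable f -> computable (fun a => `|f a|).
Proof.
move=> cf; apply: (@computable_ext _ _ (fun a => if 0 <= f a then f a else - f a)) => [a|].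
  by case: ger0P.
apply: computable_if => //; last exact: computable_oppq.
by apply: computable_leq_rat => //; apply: computable_const.
Qed.
End RatOps.

Ltac comp_num :=
  lazymatch goal with
  | |- computable (fun a => ((@?f a) + (@?g a))%R) =>
      first [apply: (@computable_addq _ f g) | apply: (@computable_addz _ f g)]
  | |- computable (fun a => ((@?f a) * (@?g a))%R) =>
      first [apply: (@computable_mulq _ f g) | apply: (@computable_mulz _ f g)]
  | |- computable (fun a => (- (@?f a))%R) =>
      first [apply: (@computable_oppq _ f) | apply: (@computable_oppz _ f)]
  | |- computable (fun a => ((@?n a)%:R^-1)%R) => apply: (@computable_natV _ n)
  | |- computable (fun a => ((@?n a)%:R)%R) => apply: (@computable_natq _ n)
  | |- computable (fun a => ((@?n a)%:~R)%R) => apply: (@computable_intq _ n)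
  | |- computable (fun a => ((@?f a) <= (@?g a))%R) => apply: (@computable_leq_rat _ f g)
  | |- computable (fun a => ((@?f a) < (@?g a))%R) => apply: (@computable_lt_rat _ f g)
  | |- computable (fun a => (`|@?f a|)%R) => apply: (@computable_normq _ f)
  | |- computable (fun a => numq (@?f a)) => apply: (@computable_numq _ f)
  | |- computable (fun a => denq (@?f a)) => apply: (@computable_denq _ f)
  | |- computable (fun a => absz (@?f a)) => apply: (@computable_absz _ f)
  | |- computable (fun a => Posz (@?f a)) => apply: (@computable_posz _ f)
  | |- _ => comp_lists
  end.
Ltac comp_user ::= comp_num.

(** * Computable decoding *)

Section Decoding.
(** An option is presented as a list of length at most one, so that the list operations apply to
    it. *)
Definition decodable (T : countType) :=
  computable (fun k : nat => seq_of_opt (unpickle k : option T)).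

(** A number and the list of numbers it decodes to have the same code, so the identity program does
    it. *)
Lemma computable_decode (A : countType) (f : A -> nat) :
  computable f -> computable (fun a => CodeSeq.decode (f a)).
Proof.
apply: (computable_code comp1_id) => a.
by rewrite -[RHS]CodeSeq.decodeK; congr CodeSeq.code; exact: map_id.
Qed.

Lemma decodable_nat : decodable nat.
Proof. by apply: (@computable_ext _ _ (fun k : nat => [:: k])) => //; comp. Qed.

Lemma decodable_seq T : decodable T -> decodable (seq T).
Proof.
move=> dT; pose u k := seq_of_opt (unpickle k : option T).
apply: (@computable_ext _ _ (fun k =>
   [:: foldr (fun i s => u i ++ s) [::] (CodeSeq.decode k)])) => [k|].
  rewrite unpickle_seqE /=; congr [:: _].
  by rewrite /u; elim: (CodeSeq.decode k) => //= i s ->; case: (unpickle i).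
have cd := computable_decode (@computable_id nat); comp.
apply: (@computable_comp _ _ _ u (fun p : nat * (nat * seq T) => p.2.1)) => //; comp.
Qed.

Lemma computable_case2 (A B T : countType) (f : A -> seq T) (b : A -> B) (G : A -> T -> T -> B) :
  computable f -> computable b ->
  computable (fun p : A * (T * T) => G p.1 p.2.1 p.2.2) ->
  computable (fun a => if f a is [:: x; y] then G a x y else b a).
Proof.
move=> cf cb cG.
apply: (@computable_ext _ _ (fun a => if f a is x :: s then
    (if s is y :: t then (if t is z :: t' then b a else G a x y) else b a) else b a)) => [a|].
  by case: (f a) => [|x [|y [|z t]]].
have cb_comp (C : countType) (h : C -> A) : computable h -> computable (fun c => b (h c)).
  exact: computable_comp.
apply: (@computable_case_seq A T B f b (fun a x s => if s is y :: t then (if t is z :: t' then b a else G a x y) else b a)) => //.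
apply: (@computable_case_seq (A * (T * seq T))%type T B (fun p => p.2.2) (fun p => b p.1) (fun p y t => if t is z :: t' then b p.1 else G p.1 p.2.1 y)) => //.
- comp.
- by apply: cb_comp; comp.
apply: (@computable_case_seq ((A * (T * seq T)) * (T * seq T))%type T B (fun p => p.2.2) (fun p => G p.1.1 p.1.2.1 p.2.1) (fun p _ _ => b p.1.1)) => //.
- comp.
- apply: (@computable_comp _ _ _ _ (fun p : (A * (T * seq T)) * (T * seq T) => (p.1.1, (p.1.2.1, p.2.1))) cG).
  comp.
by apply: cb_comp; comp.
Qed.

Lemma decodable_pair T1 T2 : decodable T1 -> decodable T2 -> decodable (T1 * T2)%type.
Proof.
move=> d1 d2; pose u1 k := seq_of_opt (unpickle k : option T1).
pose u2 k := seq_of_opt (unpickle k : option T2).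
apply: (@computable_ext _ _ (fun k => if CodeSeq.decode k is [:: i; j] then
  foldr (fun x s => map (fun y => (x, y)) (u2 j)) [::] (u1 i) else [::])) => [k|].
  rewrite unpickle_pair; case: (CodeSeq.decode k) => [|a [|b []]] //=.
  rewrite /u1 /u2; case: (unpickle a : option T1) => //= x.
  by case: (unpickle b : option T2).
apply: (@computable_case2 _ _ _ CodeSeq.decode (fun=> [::])
  (fun _ i j => foldr (fun x s => map (fun y => (x, y)) (u2 j)) [::] (u1 i))).
- exact: computable_decode (computable_id _).
- exact: computable_const.
comp.
  by apply: (@computable_comp _ _ _ u2 (fun p : nat * (nat * nat) * (T1 * seq (T1 * T2)) => p.1.2.2)) => //; comp.
by apply: (@computable_comp _ _ _ u1 (fun p : nat * (nat * nat) => p.2.1)) => //; comp.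
Qed.

Lemma decodable_int : decodable int.
Proof.
pose v (p : seq nat * seq nat) : seq int := 
  if p.2 is y :: _ then [:: Negz y] else if p.1 is x :: _ then [:: Posz x] else [::].
apply: (@computable_ext _ _ (fun k => if CodeSeq.decode k is [:: i; j] then
  v (CodeSeq.decode i, CodeSeq.decode j) else [::])) => [k|].
  rewrite unpickle_int; case: (CodeSeq.decode k) => [|a [|b []]] //=.
  by rewrite /v /=; case: (CodeSeq.decode b); case: (CodeSeq.decode a).
have cv : computable v.
  apply: (@computable_case_seq _ _ _ (fun p : seq nat * seq nat => p.2)
    (fun p => if p.1 is x :: _ then [:: Posz x] else [::]) (fun _ y _ => [:: Negz y])); first by comp.
    apply: (@computable_case_seq _ _ _ (fun p : seq nat * seq nat => p.1)
      (fun p => [::]) (fun _ x _ => [:: Posz x])); comp.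
  by apply: computable_cons; [apply: computable_negz|]; comp.
apply: (@computable_case2 _ _ _ CodeSeq.decode (fun=> [::])
  (fun _ i j => v (CodeSeq.decode i, CodeSeq.decode j))).
- exact: computable_decode (computable_id _).
- exact: computable_const.
apply: (@computable_comp _ _ _ v) => //.
by apply: computable_pair; apply: computable_decode; comp.
Qed.

(** Decoding accepts only reduced fractions with positive denominator, which [ok] checks. *)
Lemma decodable_rat : decodable rat.
Proof.
have dii : decodable (int * int)%type by apply: decodable_pair decodable_int decodable_int.
pose ok (p : int * int) := (0 < p.2)%R && (gcdn `|p.1| `|p.2| == 1).
apply: (computable_code (f := fun k => foldr (fun p s => if ok p then [:: p] else [::])
   [::] (seq_of_opt (unpickle k : option (int * int)))) comp1_id).
  move=> k; rewrite unpickle_rat.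
  case: (unpickle k : option (int * int)) => //= p.
  case: insubP => /= [q okp <-|]; last by rewrite /ok => /negbTE ->.
  by rewrite (_ : ok (valq q)) // /ok; case: q {okp} => p' /= h.
comp.
apply: (@computable_ext _ _ (fun p : nat * (int * int * seq (int * int)) => if ok p.2.1 then [:: p.2.1] else [::])).
  by [].
apply: computable_if; [|comp|comp].
apply: (@computable_comp _ _ _ ok (fun p : nat * (int * int * seq (int * int)) => p.2.1)); last comp.
rewrite /ok; comp.
- apply: (@computable_ext _ _ (fun p : int * int => ~~ (p.2 <= 0)%R)) => [p|]; first by rewrite ltNge.
  by apply: computable_negb; apply: computable_lez; comp.
- by apply: computable_gcdn; comp.
Qed.

Lemma computable_unpickle (A T : countType) (x0 : T) (f : A -> nat) : decodable T -> computable f ->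
  computable (fun a => odflt x0 (unpickle (f a))).
Proof.
move=> dT cf; apply: (@computable_ext _ _ (fun a => head x0 (seq_of_opt (unpickle (f a) : option T)))).
  by move=> a; case: (unpickle (f a)).
by apply: computable_head; [comp | apply: (computable_comp dT cf)].
Qed.
End Decoding.

(** * Certified approximation of algebraic numbers *)

Local Open Scope ring_scope.

Definition qadd (x y : rat * rat) : rat * rat := (x.1 + y.1, x.2 + y.2).
Definition qmul (x y : rat * rat) : rat * rat :=
  (x.1 * y.1 - x.2 * y.2, x.1 * y.2 + x.2 * y.1).
Definition qconj (x : rat * rat) : rat * rat := (x.1, - x.2).
Definition qnorm1 (x : rat * rat) : rat := `|x.1| + `|x.2|.
Definition qhorner (cs : seq int) (g : rat * rat) : rat * rat :=
  foldr (fun (c : int) r => qadd (qmul r g) (c%:~R, 0)) (0, 0) cs.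

(* Bounds for the modulus and the Lipschitz constant of a polynomial on the
   ball of radius [B], for the norm |Re| + |Im|. *)
Definition qlip (B : rat) (cs : seq int) : rat * rat :=
  foldr (fun (c : int) (r : rat * rat) => (`|c%:~R| + B * r.1, B * r.2 + r.1)) (0, 0) cs.

Definition gridpt (a b c d : rat) (M u v : nat) : rat * rat :=
  (a + (b - a) * (u%:R * M%:R^-1), c + (d - c) * (v%:R * M%:R^-1)).

Definition qclose (x y : rat * rat) (e : rat) : bool :=
  (`|x.1 - y.1| <= e) && (`|x.2 - y.2| <= e).

(* By the Lipschitz bound, a grid point violating the last inequality is the only
   kind that can lie in the same cell as a root; these must be within [e] of [x]. *)
Definition grid_test (cs : seq int) (a b c d : rat) (x : rat * rat) (e : rat) (M : nat) : bool :=
  [&& b - a <= e * M%:R, d - c <= e * M%:R &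
   all (fun u => all (fun v => qclose (gridpt a b c d M u v) x e ||
      ((qlip (`|a| + `|b| + (`|c| + `|d|)) cs).2 * ((b - a) + (d - c)) <
       qnorm1 (qhorner cs (gridpt a b c d M u v)) * M%:R)) (iota 0 M.+1)) (iota 0 M.+1)].

Definition alg_code (k : nat) : seq int * (rat * rat * rat * rat) :=
  odflt ([::], (0, 0, 0, 0)) (unpickle k).

(** If true, the coded number is within [2 e] of [x] in both coordinates; if it is within [e / 2],
    the test is true for all large [M]. A search over [M] therefore certifies closeness. *)
Definition near_root (k : nat) (x : rat * rat) (e : rat) (M : nat) : bool :=
  (0 < M)%N && grid_test (alg_code k).1 (alg_code k).2.1.1.1 (alg_code k).2.1.1.2 (alg_code k).2.1.2
    (alg_code k).2.2 x e M.

(** * Soundness of the grid test *)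

Section Norm1.
Variable R : realType.
Local Notation C := (complex R).

Definition embC (x : rat * rat) : C := Complex (ratr x.1) (ratr x.2).
(** Chosen over the modulus because it is rational on points of [Q(i)], while still
    submultiplicative. *)
Definition norm1 (z : C) : R := `|complex.Re z| + `|complex.Im z|.

Lemma embCD x y : embC (qadd x y) = embC x + embC y.
Proof. by rewrite /embC /= !rmorphD. Qed.
Lemma embCM x y : embC (qmul x y) = embC x * embC y.
Proof. by rewrite /embC /qmul /= rmorphD rmorphN !rmorphM rmorphD !rmorphM. Qed.
Lemma embC_conj x : embC (qconj x) = Num.conj (embC x).
Proof. by rewrite /embC /= rmorphN. Qed.
Lemma embC_norm1 x : norm1 (embC x) = ratr (qnorm1 x).
Proof. by rewrite /norm1 /= rmorphD /= !ratr_norm. Qed.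

Lemma norm1_ge0 z : 0 <= norm1 z. Proof. by rewrite addr_ge0. Qed.
Lemma norm1D y z : norm1 (y + z) <= norm1 y + norm1 z.
Proof.
case: y z => [a b] [c d]; rewrite /norm1 /= addrACA.
by rewrite lerD ?ler_normD.
Qed.
Lemma norm1N z : norm1 (- z) = norm1 z.
Proof. by case: z => a b; rewrite /norm1 /= !normrN. Qed.
Lemma norm1M y z : norm1 (y * z) <= norm1 y * norm1 z.
Proof.
case: y z => [a b] [c d]; rewrite /norm1 /= .
apply: le_trans (lerD (ler_normB _ _) (ler_normD _ _)) _.
by rewrite !normrM; lra.
Qed.
Lemma norm1_0 : norm1 0 = 0. Proof. by rewrite /norm1 /= normr0 addr0. Qed.
Lemma complex_int (c : int) : c%:~R = Complex (c%:~R : R) 0 :> C.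
Proof. by rewrite -[RHS]/(c%:~R)%:C%C rmorph_int. Qed.
Lemma norm1_int (c : int) : norm1 c%:~R = `|c%:~R|.
Proof. by rewrite complex_int /norm1 /= normr0 addr0. Qed.

Definition polyZ (cs : seq int) : {poly C} := Poly (map (fun i : int => i%:~R) cs).

Lemma polyZ_cons c cs z : (polyZ (c :: cs)).[z] = (polyZ cs).[z] * z + c%:~R.
Proof. by rewrite /polyZ !horner_Poly. Qed.

Lemma embC_horner cs g : embC (qhorner cs g) = (polyZ cs).[embC g].
Proof.
elim: cs => [|c cs IH] /=; first by rewrite /polyZ horner_Poly /= /embC rmorph0.
rewrite polyZ_cons -IH embCD embCM; congr (_ + _).
by rewrite /embC /= rmorph0 ratr_int complex_int.
Qed.

Lemma qlip_ge0 B cs : 0 <= B -> 0 <= (qlip B cs).1 /\ 0 <= (qlip B cs).2.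
Proof.
move=> B0; elim: cs => [|c cs [IH1 IH2]] //=.
by split; rewrite addr_ge0 ?mulr_ge0.
Qed.

(** Both bounds are carried together along Horner's scheme: the increment of [p X + c] is
    [(p(z) - p(g)) z + p(g) (z - g)], so the new Lipschitz constant involves the old bound on the
    modulus. *)
Lemma polyZ_lipschitz B cs (z g : C) : norm1 z <= ratr B -> norm1 g <= ratr B ->
  norm1 (polyZ cs).[g] <= ratr (qlip B cs).1 /\
  norm1 ((polyZ cs).[z] - (polyZ cs).[g]) <= ratr (qlip B cs).2 * norm1 (z - g).
Proof.
move=> zB gB; have B0 : 0 <= ratr B :> R := le_trans (norm1_ge0 z) zB.
have B0' : 0 <= B by rewrite -(ler0q R).
elim: cs => [|c cs [IH1 IH2]].
  by rewrite /polyZ !horner_Poly /= subr0 norm1_0 rmorph0 mul0r.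
rewrite !polyZ_cons /= !rmorphD /= !rmorphM /=; split.
  rewrite addrC; apply: le_trans (norm1D _ _) _; rewrite norm1_int ratr_norm ratr_int.
  rewrite lerD2l; apply: le_trans (norm1M _ _) _.
  by rewrite mulrC ler_pM ?norm1_ge0.
set pz := (polyZ cs).[z] in IH2 *; set pg := (polyZ cs).[g] in IH1 IH2 *.
have -> : pz * z + c%:~R - (pg * g + c%:~R) = (pz - pg) * z + pg * (z - g) by ring.
apply: le_trans (norm1D _ _) _; rewrite [leRHS]mulrDl lerD //.
  apply: le_trans (norm1M _ _) _; rewrite mulrC -mulrA.
  by rewrite ler_pM ?norm1_ge0.
by apply: le_trans (norm1M _ _) _; rewrite ler_wpM2r ?norm1_ge0.
Qed.

Lemma grid_approx (a b x : R) (M : nat) : (0 < M)%N -> a <= x <= b ->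
  exists2 u, (u <= M)%N & `|x - (a + (b - a) * (u%:R * M%:R^-1))| <= (b - a) / M%:R.
Proof.
move=> M0 /andP[ax xb]; have M0' : 0 < M%:R :> R by rewrite ltr0n.
(* Boxes may be degenerate; then [b - a] cannot be divided by. *)
have [ba|ab] := leP b a.
  have -> : b = a by lra. 
  by exists 0%N => //; rewrite mul0r mulr0 addr0 subrr mul0r normr_le0; lra.
have ba0 : 0 < b - a by lra.
pose t := (x - a) / (b - a) * M%:R.
have t0 : 0 <= t by rewrite mulr_ge0 ?divr_ge0 //; lra.
have tM : t <= M%:R by rewrite ler_piMl // ler_pdivrMr ?mul1r //; lra.
have /andP[t1 t2] := truncn_itv t0.
exists (Num.truncn t); first by rewrite -(ler_nat R) (le_trans t1).
have -> : x - (a + (b - a) * ((Num.truncn t)%:R * M%:R^-1)) =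
   (t - (Num.truncn t)%:R) * ((b - a) / M%:R).
  by rewrite /t; field; rewrite !gt_eqF.
rewrite normrM [X in _ * X]gtr0_norm ?divr_gt0 //.
rewrite -[leRHS]mul1r ler_wpM2r ?divr_ge0 ?ltW //.
by move: t2; rewrite -natr1 ltr_norml => t2; lra.
Qed.

Lemma embC_gridpt a b c d M u v : embC (gridpt a b c d M u v) =
  Complex (ratr a + (ratr b - ratr a) * (u%:R * M%:R^-1))
          (ratr c + (ratr d - ratr c) * (v%:R * M%:R^-1)).
Proof.
by rewrite /embC /gridpt /= !(rmorphD, rmorphM, rmorphN, fmorphV, rmorph_nat).
Qed.

Lemma qcloseP x y e : reflect
  (`|complex.Re (embC x) - ratr y.1| <= ratr e /\ `|complex.Im (embC x) - ratr y.2| <= ratr e)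
  (qclose x y e).
Proof.
by apply: (iffP andP); rewrite /= -!rmorphB /= -!ratr_norm !ler_rat.
Qed.

Lemma box_norm1 (a b c d x y : R) : a <= x <= b -> c <= y <= d ->
  norm1 (Complex x y) <= `|a| + `|b| + (`|c| + `|d|).
Proof.
move=> /andP[? ?] /andP[? ?]; rewrite /norm1 /= lerD // ler_norml.
  by have := ler_norm (- a); have := ler_norm b; rewrite normrN; have := normr_ge0 a; have := normr_ge0 b; lra.
by have := ler_norm (- c); have := ler_norm d; rewrite normrN; have := normr_ge0 c; have := normr_ge0 d; lra.
Qed.

Lemma ratr_boxnorm (a b c d : rat) : ratr (`|a| + `|b| + (`|c| + `|d|)) =
  `|ratr a| + `|ratr b| + (`|ratr c| + `|ratr d|) :> R.
Proof. by rewrite !rmorphD /= !ratr_norm. Qed.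

Lemma gridpt_box (a b : R) M u : (0 < M)%N -> (u <= M)%N -> a <= b ->
  a <= a + (b - a) * (u%:R * M%:R^-1) <= b.
Proof.
move=> M0 uM ab; have M0' : 0 < M%:R :> R by rewrite ltr0n.
have h0 : 0 <= u%:R / M%:R :> R by rewrite divr_ge0.
have h1 : u%:R / M%:R <= 1 :> R by rewrite ler_pdivrMr // mul1r ler_nat.
by apply/andP; split; nra.
Qed.

(** Let [g] be the grid point next to the root [z]. Its Lipschitz bound rules out the second
    alternative of the test, so [g] is within [e] of [x]; the mesh contributes the other [e]. *)
Lemma grid_test_sound cs a b c d x e M (z : C) : (0 < M)%N ->
  grid_test cs a b c d x e M -> root (polyZ cs) z ->
  ratr a <= complex.Re z <= ratr b -> ratr c <= complex.Im z <= ratr d ->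
  `|complex.Re z - ratr x.1| <= ratr (2 * e) /\ `|complex.Im z - ratr x.2| <= ratr (2 * e).
Proof.
move=> M0 /and3P[ba dc /allP tst] /rootP z0 zre zim.
have M0' : 0 < M%:R :> R by rewrite ltr0n.
have [u uM hu] := grid_approx M0 zre; have [v vM hv] := grid_approx M0 zim.
have := tst u; rewrite mem_iota add0n ltnS => /(_ uM)/allP/(_ v).
rewrite mem_iota add0n ltnS => /(_ vM).
set g := gridpt _ _ _ _ _ _ _.
have gE := embC_gridpt a b c d M u v; rewrite -/g in gE.
have bM : (ratr b - ratr a) / M%:R <= ratr e :> R.
  by rewrite ler_pdivrMr // -rmorphB /= -(ratr_nat R) -rmorphM /= ler_rat.
have dM : (ratr d - ratr c) / M%:R <= ratr e :> R.
  by rewrite ler_pdivrMr // -rmorphB /= -(ratr_nat R) -rmorphM /= ler_rat.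
have nzg : norm1 (z - embC g) <= ((ratr b - ratr a) + (ratr d - ratr c)) / M%:R.
  rewrite gE; case: z {z0 zre zim} hu hv => zr zi /= hu hv.
  by rewrite [leRHS]mulrDl /norm1 /=; apply: lerD.
case/orP => [/qcloseP[]|].
  rewrite gE /= => h1 h2; rewrite rmorphM /= rmorph_nat; split.
    have := ler_normD (complex.Re z - (ratr a + (ratr b - ratr a) * (u%:R / M%:R)))
       (ratr a + (ratr b - ratr a) * (u%:R / M%:R) - ratr x.1).
    by rewrite subrKA; lra.
  have := ler_normD (complex.Im z - (ratr c + (ratr d - ratr c) * (v%:R / M%:R)))
       (ratr c + (ratr d - ratr c) * (v%:R / M%:R) - ratr x.2).
  by rewrite subrKA; lra.
rewrite ltNge => /negP []; set B := _ + (_ + _).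
have zB : norm1 z <= ratr B.
  by rewrite ratr_boxnorm; case: z zre zim {z0 hu hv nzg} => zr zi /=; apply: box_norm1.
have gB : norm1 (embC g) <= ratr B.
  rewrite ratr_boxnorm gE; apply: box_norm1; apply: gridpt_box => //.
    by case/andP: zre => /le_trans h /h.
  by case/andP: zim => /le_trans h /h.
have [_ ] := polyZ_lipschitz cs zB gB.
rewrite z0 sub0r norm1N -embC_horner embC_norm1.
have B0 : 0 <= B by rewrite !addr_ge0.
have [_ L0] := qlip_ge0 cs B0.
move=> h; rewrite -(ler_rat R) !rmorphM /= ratr_nat -ler_pdivlMr //.
apply: le_trans h _; rewrite -[leRHS]mulrA ler_wpM2l //; first by rewrite ler0q.
by rewrite rmorphD !rmorphB.
Qed.
End Norm1.

(** * Completeness of the grid test *)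

Section GridComplete.
Variable R : realType.
Local Notation C := (complex R).

(** Multiplicative, so lower bounds for the linear factors of a polynomial multiply. *)
Definition normsq (z : C) : R := complex.Re z ^+ 2 + complex.Im z ^+ 2.

Lemma ReB (y z : C) : complex.Re (y - z) = complex.Re y - complex.Re z.
Proof. by case: y z => [? ?] [? ?]. Qed.
Lemma ImB (y z : C) : complex.Im (y - z) = complex.Im y - complex.Im z.
Proof. by case: y z => [? ?] [? ?]. Qed.

Lemma normsq_ge0 z : 0 <= normsq z. Proof. by rewrite addr_ge0 ?sqr_ge0. Qed.
Lemma normsqM y z : normsq (y * z) = normsq y * normsq z.
Proof. by case: y z => [a b] [c d]; rewrite /normsq /=; ring. Qed.
Lemma normsq_le z : normsq z <= norm1 z ^+ 2.
Proof.
rewrite /normsq /norm1 sqrrD !real_normK ?num_real // lerD2r lerDl.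
by rewrite mulrn_wge0 ?mulr_ge0.
Qed.
Lemma normsq_gt0 z : z != 0 -> 0 < normsq z.
Proof.
move=> z0; rewrite lt_neqAle normsq_ge0 andbT eq_sym; apply: contra z0.
case: z => a b; rewrite /normsq /= paddr_eq0 ?sqr_ge0 // !sqrf_eq0.
by case/andP => /eqP -> /eqP ->.
Qed.

(** Splitting [p] into linear factors replaces a compactness argument: [D] has only to stay away
    from each root separately. *)
Lemma poly_away (p : {poly C}) (D : C -> Prop) : p != 0 ->
  (forall r, root p r -> exists2 c, 0 < c & forall w, D w -> c <= normsq (w - r)) ->
  exists2 c, 0 < c & forall w, D w -> c <= normsq p.[w].
Proof.
move=> p0 H; have [rs pE] := closed_field_poly_normal p.
have {}H r : r \in rs -> exists2 c, 0 < c & forall w, D w -> c <= normsq (w - r).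
  move=> rrs; apply: H; rewrite pE rootZ ?lead_coef_eq0 //.
  by rewrite root_prod_XsubC.
have [c c0 hc] : exists2 c, 0 < c & forall w, D w -> c <= normsq (\prod_(z <- rs) ('X - z%:P)).[w].
  elim: rs H {pE} => [|r rs IH] H.
    by exists 1 => // w _; rewrite big_nil hornerC /normsq /= expr1n expr0n addr0.
  have [c c0 hc] := H r (mem_head _ _).
  have [|c' c'0 hc'] := IH; first by move=> s srs; apply: H; rewrite in_cons srs orbT.
  exists (c * c') => [|w Dw]; first by rewrite mulr_gt0.
  by rewrite big_cons hornerM hornerXsubC normsqM ler_pM ?hc ?hc' ?ltW.
have l0 : 0 < normsq (lead_coef p) by rewrite normsq_gt0 ?lead_coef_eq0.
exists (normsq (lead_coef p) * c) => [|w Dw]; first by rewrite mulr_gt0.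
by rewrite pE hornerZ normsqM lead_coefZ lead_coef_prod_XsubC mulr1 ler_pM2l // hc.
Qed.

Lemma normsq_re (z : C) (c : R) : 0 <= c -> c <= `|complex.Re z| -> c ^+ 2 <= normsq z.
Proof.
move=> c0 h; rewrite /normsq -[X in _ <= X + _]real_normK ?num_real //.
by rewrite -[leLHS]addr0 lerD ?sqr_ge0 // lerXn2r ?nnegrE.
Qed.
Lemma normsq_im (z : C) (c : R) : 0 <= c -> c <= `|complex.Im z| -> c ^+ 2 <= normsq z.
Proof.
move=> c0 h; rewrite /normsq -[X in _ <= _ + X]real_normK ?num_real //.
by rewrite -[leLHS]add0r lerD ?sqr_ge0 // lerXn2r ?nnegrE.
Qed.

Lemma grid_test_complete cs a b c d (x : rat * rat) e (z : C) :
  polyZ R cs != 0 -> 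
  (forall w, root (polyZ R cs) w -> ratr a <= complex.Re w <= ratr b ->
    ratr c <= complex.Im w <= ratr d -> w = z) ->
  ratr a <= complex.Re z <= ratr b -> ratr c <= complex.Im z <= ratr d ->
  0 < e ->
  `|complex.Re z - ratr x.1| <= ratr e / 2 -> `|complex.Im z - ratr x.2| <= ratr e / 2 ->
  exists M0, forall M, (M0 <= M)%N -> grid_test cs a b c d x e M.
Proof.
move=> p0 uz zre zim e0 zx1 zx2.
have e0' : 0 < ratr e :> R by rewrite ltr0q.
have ab : a <= b by rewrite -(ler_rat R); case/andP: zre => /le_trans h /h.
have cd : c <= d by rewrite -(ler_rat R); case/andP: zim => /le_trans h /h.
(* The part of the box where [qclose] fails. The isolated root [z] is [e / 2] away from it because
   it is that close to [x]; every other root lies outside the closed box. *)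
pose D (w : C) := [/\ ratr a <= complex.Re w <= ratr b, ratr c <= complex.Im w <= ratr d &
  ~ (`|complex.Re w - ratr x.1| <= ratr e /\ `|complex.Im w - ratr x.2| <= ratr e)].
have [|k k0 hk] := @poly_away _ D p0.
  move=> r pr; have [->|rz] := eqVneq r z.
    exists ((ratr e / 2) ^+ 2); first by apply: exprn_gt0; lra.
    move=> w [_ _ nx]; have e2 : 0 <= ratr e / 2 :> R by lra.
    have [h1|h1] := leP (ratr e / 2) `|complex.Re (w - z)|; first exact: normsq_re.
    have [h2|h2] := leP (ratr e / 2) `|complex.Im (w - z)|; first exact: normsq_im.
    case: nx; split.
      have := ler_normD (complex.Re w - complex.Re z) (complex.Re z - ratr x.1).
      by rewrite subrKA; move: h1; rewrite ReB; lra.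
    have := ler_normD (complex.Im w - complex.Im z) (complex.Im z - ratr x.2).
    by rewrite subrKA; move: h2; rewrite ImB; lra.
  (* A root that violates one coordinate range of the box keeps at least the gap in that coordinate
     from the whole box. *)
  have gap (s t : R) (f : C -> R) (nf : forall (w v : C) q, 0 <= q -> q <= `|f w - f v| -> q ^+ 2 <= normsq (w - v)) :
     ~~ (s <= f r <= t) -> exists2 q, 0 < q & forall w, s <= f w <= t -> q <= normsq (w - r).
    rewrite negb_and -!ltNge => /orP[lt|lt].
      exists ((s - f r) ^+ 2) => [|w /andP[h _]]; first by rewrite exprn_gt0 ?subr_gt0.
      by apply: nf; [|rewrite ger0_norm]; lra.
    exists ((f r - t) ^+ 2) => [|w /andP[_ h]]; first by rewrite exprn_gt0 ?subr_gt0.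
    by apply: nf; [|rewrite ler0_norm]; lra.
  have [h1|h1] := boolP (ratr a <= complex.Re r <= ratr b); last first.
    have [|q q0 hq] := @gap _ _ (@complex.Re R) _ h1.
      by move=> w v q q0 h; apply: normsq_re => //; rewrite ReB.
    by exists q => // w [h _ _]; apply: hq.
  have [h2|h2] := boolP (ratr c <= complex.Im r <= ratr d); last first.
    have [|q q0 hq] := @gap _ _ (@complex.Im R) _ h2.
      by move=> w v q q0 h; apply: normsq_im => //; rewrite ImB.
    by exists q => // w [_ h _]; apply: hq.
  by rewrite (uz _ pr h1 h2) eqxx in rz.
pose L := (qlip (`|a| + `|b| + (`|c| + `|d|)) cs).2 * ((b - a) + (d - c)).
(* The first summand makes [k M] exceed [L^2]; the other two bound the side lengths of a cell by
   [e]. *)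
pose X : R := ratr L ^+ 2 / k + ratr (b - a) / ratr e + ratr (d - c) / ratr e.
have X1 : 0 <= ratr L ^+ 2 / k :> R by rewrite divr_ge0 ?sqr_ge0 ?ltW.
have X2 : 0 <= ratr (b - a) / ratr e :> R by apply: divr_ge0; [rewrite ler0q subr_ge0 | apply: ltW].
have X3 : 0 <= ratr (d - c) / ratr e :> R by apply: divr_ge0; [rewrite ler0q subr_ge0 | apply: ltW].
exists (Num.truncn X).+1 => M MX.
have MX' : X < M%:R.
  by apply: lt_le_trans (truncnS_gt X) _; rewrite ler_nat.
have M0 : (0 < M)%N by case: (M) MX.
have M1 : 1 <= M%:R :> R by rewrite ler1n.
have side (q : rat) : ratr q / ratr e <= X -> q <= e * M%:R.
  move=> h; rewrite -(ler_rat R) rmorphM /= ratr_nat mulrC -ler_pdivrMr //.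
  by apply: le_trans h _; exact: ltW.
apply/and3P; split.
- by apply: side; rewrite /X; lra.
- by apply: side; rewrite /X; lra.
apply/allP => u; rewrite mem_iota add0n ltnS => uM.
apply/allP => v; rewrite mem_iota add0n ltnS => vM.
set g := gridpt _ _ _ _ _ _ _; have [//|nc] := boolP (qclose g x e).
rewrite orFb -/L -(ltr_rat R) [ltRHS]rmorphM /= -embC_norm1 ratr_nat embC_horner.
have Dg : D (embC R g).
  split; last by move/(@qcloseP R); apply/negP.
    by rewrite embC_gridpt /= gridpt_box ?ler_rat.
  by rewrite embC_gridpt /= gridpt_box ?ler_rat.
have := hk _ Dg; set n := norm1 _; have := normsq_le (polyZ R cs).[embC R g].
rewrite -/n => h1 h2; have kn := le_trans h2 h1.
rewrite ltNge; apply/negP => nL.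
have n0 : 0 <= n := norm1_ge0 _.
(* If the Lipschitz inequality failed, [k M <= n^2 M^2 <= L^2] would contradict the choice of
   [M]. *)
have : k * M%:R <= ratr L ^+ 2.
  apply: le_trans (_ : n ^+ 2 * M%:R ^+ 2 <= _).
    have M2 : M%:R <= M%:R ^+ 2 :> R by rewrite expr2 ler_peMl.
    by apply: ler_pM => //; exact: ltW.
  have nM0 : 0 <= n * M%:R by rewrite mulr_ge0.
  by rewrite -exprMn; apply: lerXn2r => //; rewrite nnegrE // (le_trans nM0).
rewrite mulrC -ler_pdivlMr //; rewrite /X in MX'; lra.
Qed.

Lemma near_root_sound k x e M (z : C) : codesAlg k z -> near_root k x e M ->
  `|complex.Re z - ratr x.1| <= ratr (2 * e) /\ `|complex.Im z - ratr x.2| <= ratr (2 * e).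
Proof.
move=> [cs [a [b [c [d [kE [p0 rz zre zim _]]]]]]] /andP[M0].
rewrite /alg_code kE /= => tst.
exact: (grid_test_sound M0 tst rz).
Qed.

Lemma near_root_complete k (x : rat * rat) e (z : C) : codesAlg k z -> 0 < e ->
  `|complex.Re z - ratr x.1| <= ratr e / 2 -> `|complex.Im z - ratr x.2| <= ratr e / 2 ->
  exists M0, forall M, (M0 <= M)%N -> near_root k x e M.
Proof.
move=> [cs [a [b [c [d [kE [p0 rz zre zim uz]]]]]]] e0 h1 h2.
have [M0 hM] := grid_test_complete p0 uz zre zim e0 h1 h2.
exists M0.+1 => M MM; rewrite /near_root /alg_code kE.
apply/andP; split; first exact: leq_ltn_trans MM.
exact: (hM _ (ltnW MM)).
Qed.
End GridComplete.

Lemma computable_qadd (A : countType) (f g : A -> rat * rat) :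
  computable f -> computable g -> computable (fun a => qadd (f a) (g a)).
Proof. by move=> cf cg; rewrite /qadd; comp. Qed.
Lemma computable_qmul (A : countType) (f g : A -> rat * rat) :
  computable f -> computable g -> computable (fun a => qmul (f a) (g a)).
Proof. by move=> cf cg; rewrite /qmul; comp. Qed.
Lemma computable_qconj (A : countType) (f : A -> rat * rat) :
  computable f -> computable (fun a => qconj (f a)).
Proof. by move=> cf; rewrite /qconj; comp. Qed.
Lemma computable_qnorm1 (A : countType) (f : A -> rat * rat) :
  computable f -> computable (fun a => qnorm1 (f a)).
Proof. by move=> cf; rewrite /qnorm1; comp. Qed.

Ltac comp_qc :=
  lazymatch goal with
  | |- computable (fun a => qadd (@?f a) (@?g a)) => apply: (@computable_qadd _ f g)
  | |- computable (fun a => qmul (@?f a) (@?g a)) => apply: (@computable_qmul _ f g)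
  | |- computable (fun a => qconj (@?f a)) => apply: (@computable_qconj _ f)
  | |- computable (fun a => qnorm1 (@?f a)) => apply: (@computable_qnorm1 _ f)
  | |- _ => comp_num
  end.
Ltac comp_user ::= comp_qc.

Lemma computable_alg_code (A : countType) (k : A -> nat) : computable k ->
  computable (fun a => alg_code (k a)).
Proof.
move=> ck; apply: computable_unpickle => //.
apply: decodable_pair; first exact: decodable_seq decodable_int.
by do 3 (apply: decodable_pair; last exact: decodable_rat); exact: decodable_rat.
Qed.

Lemma computable_near_root : computable (fun p : nat * (rat * rat) * rat * nat =>
  near_root p.1.1.1 p.1.1.2 p.1.2 p.2).
Proof.
pose G (q : (seq int * (rat * rat * rat * rat)) * ((rat * rat) * rat * nat)) :=
  (0 < q.2.2)%N && grid_test q.1.1 q.1.2.1.1.1 q.1.2.1.1.2 q.1.2.1.2 q.1.2.2 q.2.1.1 q.2.1.2 q.2.2.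
suff cG : computable G.
  apply: (@computable_comp _ _ _ G (fun p : nat * (rat * rat) * rat * nat =>
    (alg_code p.1.1.1, (p.1.1.2, p.1.2, p.2))) cG).
  by apply: computable_pair; [apply: computable_alg_code|]; comp.
by rewrite /G /grid_test /qclose /qlip /qhorner /gridpt; comp.
Qed.

(** * Rational orthonormal families *)

Section Adjoint.
Variable R : realType.
Local Notation C := (complex R).

Lemma adjmxE m n (A : 'M[C]_(m, n)) i j : adj A i j = Num.conj (A j i).
Proof. by rewrite /adj !mxE. Qed.
Lemma adjmxK m n (A : 'M[C]_(m, n)) : adj (adj A) = A.
Proof. by apply/matrixP => i j; rewrite !adjmxE conjCK. Qed.
Lemma adjmxM m n p (A : 'M[C]_(m, n)) (B : 'M[C]_(n, p)) : adj (A *m B) = adj B *m adj A.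
Proof. by rewrite /adj map_mxM trmx_mul. Qed.
Lemma adjmxD m n (A B : 'M[C]_(m, n)) : adj (A + B) = adj A + adj B.
Proof. by rewrite /adj map_mxD linearD. Qed.
Lemma adjmxN m n (A : 'M[C]_(m, n)) : adj (- A) = - adj A.
Proof. by rewrite /adj map_mxN linearN. Qed.
Lemma adjmxZ m n c (A : 'M[C]_(m, n)) : adj (c *: A) = Num.conj c *: adj A.
Proof. by rewrite /adj map_mxZ linearZ. Qed.
Lemma adjmx1 n : adj 1%:M = 1%:M :> 'M[C]_n.
Proof. by rewrite /adj map_scalar_mx rmorph1 tr_scalar_mx. Qed.
Lemma adj_invmx n (A : 'M[C]_n) : adj (invmx A) = invmx (adj A).
Proof. by rewrite /adj map_invmx trmx_inv. Qed.

Lemma ReD (y z : C) : complex.Re (y + z) = complex.Re y + complex.Re z.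
Proof. by case: y z => [? ?] [? ?]. Qed.
Lemma Re_sum I (r : seq I) (P : pred I) (F : I -> C) :
  complex.Re (\sum_(i <- r | P i) F i) = \sum_(i <- r | P i) complex.Re (F i).
Proof. by apply: (big_morph _ ReD). Qed.
Lemma Re_mulconj (z : C) : complex.Re (z * Num.conj z) = normsq z.
Proof. by case: z => a b; rewrite /normsq /=; ring. Qed.
Lemma norm1_conj (z : C) : norm1 (Num.conj z) = norm1 z.
Proof. by case: z => a b; rewrite /norm1 /= normrN. Qed.
Lemma norm1_sum I (r : seq I) (P : pred I) (F : I -> C) :
  norm1 (\sum_(i <- r | P i) F i) <= \sum_(i <- r | P i) norm1 (F i).
Proof.
elim/big_rec2: _ => [|i y x _ h]; first by rewrite norm1_0.
by apply: le_trans (norm1D _ _) _; rewrite lerD2l.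
Qed.
Lemma normsq_norm1 (z : C) : normsq z <= 1 -> norm1 z <= 2.
Proof.
rewrite /normsq /norm1 -(real_normK (num_real (complex.Re z))) -(real_normK (num_real (complex.Im z))).
set a := `|_|; set b := `|_| => h.
by have := sqr_ge0 (a - 1); have := sqr_ge0 (b - 1); lra.
Qed.
Lemma mulmx_adj_diag m n (K : 'M[C]_(m, n)) i :
  complex.Re ((K *m adj K) i i) = \sum_j normsq (K i j).
Proof. by rewrite mxE Re_sum; apply: eq_bigr => j _; rewrite adjmxE Re_mulconj. Qed.

Lemma mulmx_adj_eq0 m n (K : 'M[C]_(m, n)) : K *m adj K = 0 -> K = 0.
Proof.
move=> K0; apply/matrixP => i j; rewrite mxE.
have := mulmx_adj_diag K i; rewrite K0 mxE /= => /esym/eqP.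
rewrite psumr_eq0; last by move=> k _; apply: normsq_ge0.
move=> /allP/(_ j); rewrite mem_index_enum => /(_ isT) /= h.
by apply/eqP; apply: contraTT h => h; rewrite gt_eqF // normsq_gt0.
Qed.

(** If [K (1 + B) = 0], then [K B adj K = - K adj K] is Hermitian, and it is skew-Hermitian because
    [B] is. Hence [K adj K = 0]. *)
Lemma skew_unit n (B : 'M[C]_n) : adj B = - B -> 1%:M + B \in unitmx.
Proof.
move=> sB; rewrite -row_free_unit -kermx_eq0; apply/eqP; set K := kermx _.
have /eqP : K *m (1%:M + B) = 0 by apply: mulmx_ker.
rewrite mulmxDr mulmx1 addrC addr_eq0 => /eqP KB; clearbody K.
apply: mulmx_adj_eq0.
have h1 : K *m B *m adj K = - (K *m adj K) by rewrite KB mulNmx.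
have h2 : K *m B *m adj K = K *m adj K.
  have := congr1 (@adj _ _ _) h1; rewrite adjmxN !adjmxM adjmxK sB mulNmx mulmxN.
  by move=> /oppr_inj; rewrite mulmxA.
have : (K *m adj K) *+ 2 = 0 by rewrite mulr2n -{1}h2 h1 addNr.
move/matrixP => h; apply/matrixP => i j; have := h i j.
by rewrite mulr2n !mxE -mulr2n => /eqP; rewrite mulrn_eq0 /= => /eqP.
Qed.

(** This is [(1 - B) (1 + B)^-1], written with a single occurrence of [B]; where defined, it is an
    involution. *)
Definition cayley n (B : 'M[C]_n) : 'M[C]_n := 2 *: invmx (1%:M + B) - 1%:M.

Section Skew.
Variables (n : nat) (B : 'M[C]_n).
Hypothesis sB : adj B = - B.
Let X := invmx (1%:M + B).


(** The adjoint of [1 + B] is [1 - B], so [adj X] and [X] are [adj X (1 + B) X] and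
    [adj X (1 - B) X], where [B] cancels in the sum. The identity yields both the unitarity of
    [2 X - 1] and a bound on [X]. *)
Lemma skew_inv_adj : adj X + X = 2 *: (adj X *m X).
Proof.
have u1 := skew_unit sB.
have u2 : 1%:M - B \in unitmx by apply: skew_unit; rewrite adjmxN sB.
have aX : adj X = invmx (1%:M - B) by rewrite adj_invmx adjmxD adjmx1 sB.
have e1 : adj X *m (1%:M + B) *m X = adj X by rewrite mulmxK.
have e2 : adj X *m (1%:M - B) *m X = X by rewrite aX mulVmx // mul1mx.
transitivity (adj X *m (1%:M + B) *m X + adj X *m (1%:M - B) *m X); first by rewrite e1 e2.
rewrite -mulmxDl -mulmxDr addrACA subrr addr0 -mulr2n.
by rewrite -scaler_nat -scalemxAr -scalemxAl mulmx1.
Qed.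

Lemma cayley_unitary : adj (cayley B) *m cayley B = 1%:M.
Proof.
rewrite /cayley -/X adjmxD adjmxN adjmx1 adjmxZ.
have -> : Num.conj 2 = 2 :> C by rewrite conjC_nat.
rewrite mulmxBl !mulmxBr mulmx1 !mul1mx -scalemxAl -scalemxAr -skew_inv_adj.
rewrite scalerDr; set a := 2 *: adj X; set b := 2 *: X; clearbody a b.
by apply/matrixP => i j; rewrite !mxE; ring.
Qed.

(** The diagonal of the identity says that the real part of [X j j] is the squared length of column
    [j]. That length dominates the square of the same real part, so both are at most 1. The bound
    does not depend on [B]. *)
Lemma skew_inv_bound i j : norm1 (X i j) <= 2.
Proof.
apply: normsq_norm1.
have := congr1 (fun M : 'M[C]_n => complex.Re (M j j)) skew_inv_adj.
rewrite mxE adjmxE ReD /=.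
have -> : complex.Re (Num.conj (X j j)) = complex.Re (X j j) by case: (X j j).
have -> : complex.Re ((2 *: (adj X *m X)) j j) = 2 * \sum_k normsq (X k j).
  rewrite -{2}[X](adjmxK X) mxE; set T := adj X.
  have -> : complex.Re (2 * (T *m adj T) j j) = 2 * complex.Re ((T *m adj T) j j).
    by rewrite !mulr_natl !mulr2n ReD.
  rewrite mulmx_adj_diag; congr (_ * _); apply: eq_bigr => k _.
  by rewrite /T adjmxE /normsq; case: (X k j) => a b /=; rewrite sqrrN.
rewrite -mulr2n -[_ *+ 2]mulr_natl => /mulfI h.
have {h}E : complex.Re (X j j) = \sum_k normsq (X k j) by apply: h; rewrite pnatr_eq0.
have le k : normsq (X k j) <= complex.Re (X j j).
  by rewrite E (bigD1 k) //= lerDl sumr_ge0 // => *; apply: normsq_ge0.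
have le1 : complex.Re (X j j) <= 1.
  have := le j; rewrite /normsq; have := sqr_ge0 (complex.Im (X j j)); nra.
exact: le_trans (le i) le1.
Qed.
End Skew.

Lemma mulmx_bound m n p (A : 'M[C]_(m, n)) (B : 'M[C]_(n, p)) a b :
  (forall i j, norm1 (A i j) <= a) -> (forall i j, norm1 (B i j) <= b) ->
  forall i j, norm1 ((A *m B) i j) <= n%:R * (a * b).
Proof.
move=> hA hB i j; rewrite mxE; apply: le_trans (norm1_sum _ _ _) _.
apply: le_trans (_ : \sum_(k < n) a * b <= _).
  by apply: ler_sum => k _; apply: le_trans (norm1M _ _) _; rewrite ler_pM ?norm1_ge0.
by rewrite sumr_const card_ord mulr_natl.
Qed.

(** Resolvent identity [Y - X = Y (A - B) X] for the inverses. Entries of [X] and [Y] are bounded by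
    2, and each product costs a factor [n]. *)
Lemma cayley_close n (A B : 'M[C]_n) e : adj A = - A -> adj B = - B ->
  (forall i j, norm1 (A i j - B i j) <= e) ->
  forall i j, norm1 (cayley B i j - cayley A i j) <= 2 * (n%:R * (n%:R * (2 * e) * 2)).
Proof.
move=> sA sB AB i j.
have uA := skew_unit sA; have uB := skew_unit sB.
pose X := invmx (1%:M + A); pose Y := invmx (1%:M + B).
have E : Y - X = Y *m (A - B) *m X.
  have -> : A - B = (1%:M + A) - (1%:M + B) by rewrite opprD addrACA subrr add0r.
  by rewrite mulmxBr mulmxBl mulmxK // mulVmx // mul1mx.
have -> : cayley B i j - cayley A i j = 2 * (Y - X) i j.
  by rewrite /cayley -/X -/Y !mxE; ring.
have -> : norm1 (2 * (Y - X) i j) = 2 * norm1 ((Y - X) i j).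
  rewrite mulr_natl mulr2n /norm1 mulrDr; case: ((Y - X) i j) => x y /=.
  by rewrite -!mulr2n !normrMn !mulr_natl.
rewrite ler_pM2l // E; apply: mulmx_bound => [k l|k l]; last exact: skew_inv_bound.
by apply: mulmx_bound => k' l'; [exact: skew_inv_bound|rewrite !mxE].
Qed.

(** By involutivity [A] is the Cayley transform of [V]. With [Y = (1 + V)^-1], unitarity gives
    [adj Y = Y V], so [Y + adj Y = 1] and [2 Y - 1] is skew-Hermitian. *)
Lemma unitary_cayley n (V : 'M[C]_n) : adj V *m V = 1%:M -> 1%:M + V \in unitmx ->
  exists2 A, adj A = - A & cayley A = V.
Proof.
move=> uV u1; pose Y := invmx (1%:M + V); exists (2 *: Y - 1%:M).
  have YV : adj Y = Y *m V.
    have e : adj (1%:M + V) *m V = 1%:M + V.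
      by rewrite adjmxD adjmx1 mulmxDl mul1mx uV addrC.
    have u2 : adj (1%:M + V) \in unitmx by rewrite /adj unitmx_tr map_unitmx.
    have TVY : adj (1%:M + V) *m (V *m Y) = 1%:M by rewrite mulmxA e mulmxV.
    have cTV : (1%:M + V) *m V = V *m (1%:M + V) by rewrite mulmxDr mulmxDl mulmx1 mul1mx.
    have VY : V *m Y = Y *m V.
      by rewrite -[LHS](mulKmx u1) [X in _ *m X]mulmxA cTV -mulmxA mulmxV // mulmx1.
    by rewrite adj_invmx -VY; apply: (can_inj (mulKmx u2)); rewrite TVY mulmxV.
  rewrite adjmxD adjmxN adjmx1 adjmxZ YV.
  have -> : Num.conj 2 = 2 :> C by rewrite conjC_nat.
  have : Y + Y *m V = 1%:M by rewrite -{1}[Y]mulmx1 -mulmxDr mulVmx.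
  move/(canRL (addKr _)) => ->; apply/matrixP => i j; rewrite !mxE; ring.
rewrite /cayley addrCA subrr addr0.
have n2 : (2 : C) \is a GRing.unit by rewrite unitfE pnatr_eq0.
have uY : Y \in unitmx by rewrite unitmx_inv.
by rewrite invmxZ ?unitmxZ // invmxK scalerA divrr // scale1r addrAC subrr add0r.
Qed.
End Adjoint.

(** * Orthonormal families with entries in [Q(i)] *)

Definition qdot (N : nat) (v w : seq (rat * rat)) : rat * rat :=
  foldr (fun i r => qadd (qmul (qconj (nth (0, 0) v i)) (nth (0, 0) w i)) r) (0, 0) (iota 0 N).

Definition qproj (F : seq (seq (rat * rat))) (i j : nat) : rat * rat :=
  foldr (fun v r => qadd (qmul (nth (0, 0) v i) (qconj (nth (0, 0) v j))) r) (0, 0) F.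

(** Rational entries allow orthonormality to be tested exactly; only the closeness of [qproj] to a
    given projection is approximate. *)
Definition qframe (N : nat) (F : seq (seq (rat * rat))) : bool :=
  all (fun v => size v == N) F &&
  all (fun i => all (fun j => qdot N (nth [::] F i) (nth [::] F j) ==
     ((i == j)%:R, 0)) (iota 0 (size F))) (iota 0 (size F)).

Section RationalFrames.
Variable R : realType.
Local Notation C := (complex R).
Local Notation embC := (embC R).

Lemma embC0 : embC (0, 0) = 0. Proof. by rewrite /embC /= rmorph0. Qed.
Lemma embC_nat n : embC (n%:R, 0) = n%:R.
Proof. by rewrite /embC /= rmorph0 ratr_nat -[n%:R]/(1 *+ n) -[RHS](rmorph_nat (real_complex R)). Qed.
Lemma embC_inj : injective embC.
Proof.
by move=> [a b] [c d] [/(fmorph_inj (ratr : rat -> R)) -> /(fmorph_inj (ratr : rat -> R)) ->].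
Qed.

Lemma embC_qdot N v w :
  embC (qdot N v w) = \sum_(i < N) Num.conj (embC (nth (0, 0) v i)) * embC (nth (0, 0) w i).
Proof.
rewrite -(big_mkord xpredT (fun i => Num.conj (embC (nth (0, 0) v i)) * embC (nth (0, 0) w i))).
rewrite /index_iota subn0 /qdot; elim: (iota 0 N) => [|i s IH]; first by rewrite big_nil embC0.
by rewrite big_cons -IH /= embCD embCM embC_conj.
Qed.

Lemma embC_qproj F i j : embC (qproj F i j) =
  \sum_(v <- F) embC (nth (0, 0) v i) * Num.conj (embC (nth (0, 0) v j)).
Proof.
elim: F => [|v F IH]; first by rewrite big_nil embC0.
by rewrite big_cons -IH /= embCD embCM embC_conj.
Qed.

Definition isQ (z : C) := exists q, z = embC q.

Lemma isQ_nat n : isQ n%:R. Proof. by exists (n%:R, 0); rewrite embC_nat. Qed.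
Lemma isQD y z : isQ y -> isQ z -> isQ (y + z).
Proof. by move=> [p ->] [q ->]; exists (qadd p q); rewrite embCD. Qed.
Lemma isQM y z : isQ y -> isQ z -> isQ (y * z).
Proof. by move=> [p ->] [q ->]; exists (qmul p q); rewrite embCM. Qed.
Lemma isQN z : isQ z -> isQ (- z).
Proof. by move=> [p ->]; exists (- p.1, - p.2); rewrite /embC /= !rmorphN. Qed.
Lemma isQV z : isQ z -> isQ z^-1.
Proof.
move=> [[a b] ->].
exists (a / (a ^+ 2 + b ^+ 2), - b / (a ^+ 2 + b ^+ 2)).
by rewrite /embC /= !(rmorphM, rmorphN, fmorphV, rmorphD, rmorphXn) /= !mulNr.
Qed.
Lemma isQ_sign (n : nat) : isQ ((-1) ^+ n).
Proof.
by elim: n => [|n IH]; rewrite ?expr0 ?exprS; [exact: isQ_nat 1|apply: isQM IH; exact/isQN/(isQ_nat 1)].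
Qed.

Lemma isQ_det n (A : 'M[C]_n) : (forall i j, isQ (A i j)) -> isQ (\det A).
Proof.
move=> hA; rewrite /determinant; apply: (big_ind isQ) => [||s _].
- exact: isQ_nat 0.
- exact: isQD.
apply: isQM; first exact: isQ_sign.
by apply: (big_ind isQ) => //; [exact: isQ_nat 1 | exact: isQM].
Qed.

Lemma isQ_invmx n (A : 'M[C]_n) : (forall i j, isQ (A i j)) -> forall i j, isQ (invmx A i j).
Proof.
move=> hA i j; rewrite /invmx; case: ifP => // _; rewrite !mxE.
apply: isQM; first exact/isQV/isQ_det.
rewrite /cofactor; apply: isQM; first exact: isQ_sign.
by apply: isQ_det => k l; rewrite !mxE.
Qed.

Lemma isQ_cayley n (B : 'M[C]_n) : (forall i j, isQ (B i j)) -> forall i j, isQ (cayley B i j).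
Proof.
move=> hB i j; rewrite /cayley !mxE.
apply: isQD; last by apply: isQN; apply: isQ_nat.
apply: isQM; first exact: isQ_nat 2.
by apply: isQ_invmx => k l; rewrite !mxE; apply: isQD => //; apply: isQ_nat.
Qed.

Lemma ratr_approx (x e : R) : 0 < e -> exists q : rat, `|x - ratr q| <= e.
Proof.
move=> e0; have xe : x - e < x + e by lra.
have [q] := rat_in_itvoo xe.
by rewrite in_itv /= => h; exists q; rewrite ler_norml; lra.
Qed.

Lemma skew_approx n (A : 'M[C]_n) e : adj A = - A -> 0 < e ->
  exists B, [/\ adj B = - B, forall i j, isQ (B i j) & forall i j, norm1 (A i j - B i j) <= e].
Proof.
move=> sA e0; have e2 : 0 < e / 2 by lra.
have [q hq] : exists q : 'I_n -> 'I_n -> rat * rat, forall i j,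
    norm1 (A i j - embC (q i j)) <= e.
  have H (p : 'I_n * 'I_n) : exists q : rat * rat, norm1 (A p.1 p.2 - embC q) <= e.
    have [a ha] := ratr_approx (complex.Re (A p.1 p.2)) e2.
    have [b hb] := ratr_approx (complex.Im (A p.1 p.2)) e2.
    by exists (a, b); rewrite /norm1 ReB ImB /=; lra.
  have [f hf] := choice H.
  by exists (fun i j => f (i, j)) => i j; exact: (hf (i, j)).
pose Q : 'M[C]_n := \matrix_(i, j) embC (q i j).
(* Entrywise rounding destroys skewness. Taking the skew part restores it, and since [A] is its own
   skew part the error does not grow. *)
pose B := 2^-1 *: (Q - adj Q); exists B.
have c2 : Num.conj (2^-1 : C) = 2^-1.
  by rewrite fmorphV; congr (_^-1); exact: conjC_nat.
split.
- by rewrite adjmxZ adjmxD adjmxN adjmxK c2 -scalerN opprB.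
- move=> i j; rewrite !mxE; apply: isQM; first exact/isQV/(isQ_nat 2).
  by apply: isQD; [eexists|apply: isQN; eexists; rewrite -embC_conj].
move=> i j.
have Aij : A i j = 2^-1 * (A i j - adj A i j).
  by rewrite sA mxE opprK -mulr2n -[A i j *+ 2]mulr_natl mulrA mulVf ?mul1r // pnatr_eq0.
have Bij : B i j = 2^-1 * (embC (q i j) - Num.conj (embC (q j i))).
  by rewrite /B /Q /adj !mxE.
have -> : A i j - B i j = 2^-1 * ((A i j - embC (q i j)) - Num.conj (A j i - embC (q j i))).
  by rewrite {1}Aij adjmxE Bij rmorphB; ring.
have half z : norm1 (2^-1 * z : C) = norm1 z / 2.
  have -> : 2^-1 * z = Complex (complex.Re z / 2) (complex.Im z / 2).
    have {1}-> : z = 2 * Complex (complex.Re z / 2) (complex.Im z / 2).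
      by rewrite mulr_natl mulr2n; case: z => a b /=; congr Complex; lra.
    by rewrite mulrA mulVf ?mul1r // pnatr_eq0.
  by rewrite /norm1 /= !normrM [`|2^-1|]gtr0_norm ?invr_gt0 // -mulrDl.
rewrite half; have := norm1D (A i j - embC (q i j)) (- Num.conj (A j i - embC (q j i))).
rewrite norm1N norm1_conj; have := hq i j; have := hq j i; lra.
Qed.

(** [f] is the rational parametrisation of the unit circle. It takes infinitely many values, and the
    characteristic polynomial has only finitely many roots. *)
Lemma exists_phase n (V : 'M[C]_n) :
  exists2 mu : C, Num.conj mu * mu = 1 & V - mu%:M \in unitmx.
Proof.
pose f (t : nat) : C := Complex ((1 - t%:R ^+ 2) / (1 + t%:R ^+ 2)) (2 * t%:R / (1 + t%:R ^+ 2)).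
have d0 t : 1 + t%:R ^+ 2 != 0 :> R.
  by rewrite gt_eqF // ltr_pwDl // exprn_ge0.
have finj : injective f.
  move=> s t [] h1 h2; apply/eqP; rewrite -(eqr_nat R).
  (* The real part gives back the denominator, after which the imaginary part gives back the
     parameter. *)
  have E (u : nat) : 1 + (1 - u%:R ^+ 2) / (1 + u%:R ^+ 2) = 2 / (1 + u%:R ^+ 2) :> R.
    by field; rewrite d0.
  have e1 : 2 / (1 + s%:R ^+ 2) = 2 / (1 + t%:R ^+ 2) :> R by rewrite -!E h1.
  have e2 : s%:R * (2 / (1 + s%:R ^+ 2)) = t%:R * (2 / (1 + s%:R ^+ 2)) :> R.
    by rewrite [in RHS]e1 !mulrA ![_ * 2]mulrC.
  apply/eqP; apply: (mulIf _ e2).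
  by rewrite mulf_neq0 ?invr_eq0 ?d0 // pnatr_eq0.
have [t nt] : exists t, ~~ root (char_poly V) (f t).
  apply: contrapT => H.
  have p0 : char_poly V != 0 by rewrite monic_neq0 ?char_poly_monic.
  have := @max_poly_roots _ (char_poly V) (map f (iota 0 (size (char_poly V)))) p0.
  rewrite map_inj_uniq ?iota_uniq // size_map size_iota ltnn => /(_ _ isT) F.
  suff : false by []; apply: F; apply/allP => _ /mapP [u _ ->].
  by apply: contrapT => nr; apply: H; exists u; apply/negP.
exists (f t).
  by rewrite /f; simpc; congr Complex; [field|ring]; rewrite d0.
rewrite -row_free_unit -kermx_eq0; move: nt.
by rewrite -eigenvalue_root_char /eigenvalue negbK.
Qed.

Lemma unitary_bound n (V : 'M[C]_n) : adj V *m V = 1%:M -> forall i j, norm1 (V i j) <= 2.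
Proof.
move=> uV i j; apply: normsq_norm1.
have := mulmx_adj_diag (adj V) j; rewrite adjmxK uV mxE eqxx /= => E.
apply: le_trans (_ : normsq (adj V j i) <= _).
  by rewrite adjmxE /normsq; case: (V i j) => a b /=; rewrite sqrrN.
by rewrite E (bigD1 i) //= lerDl sumr_ge0 // => k _; apply: normsq_ge0.
Qed.

Lemma projection_spectral n (S : 'M[C]_n) : adj S = S -> S *m S = S ->
  exists P : 'M[C]_n, exists d : pred 'I_n, P *m adj P = 1%:M /\
    forall i j, S i j = \sum_(k | d k) Num.conj (P k i) * P k j.
Proof.
move=> hS iS.
have nS : S \is normalmx.
  apply/normalmxP; have -> : map_mx Num.conj S^T = S by rewrite -[RHS]hS /adj map_trmx.
  by [].
have uP := spectral_unitarymx S; have := orthomx_spectralP nS.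
move: uP; set P := spectralmx S; set sp := spectral_diag S => uP.
have aP : adj P = invmx P by rewrite (invmx_unitary uP) /adj map_trmx.
have PP : P *m adj P = 1%:M.
  by rewrite aP mulmxV // unitarymx_unit.
rewrite -aP => SE.
have Dd : diag_mx sp *m diag_mx sp = diag_mx sp.
  have dE : diag_mx sp = P *m S *m adj P.
    by rewrite SE !mulmxA PP mul1mx -mulmxA PP mulmx1.
  rewrite dE -!mulmxA (mulmxA (adj P) P) (mulmx1C PP) mul1mx.
  by rewrite (mulmxA S S) iS.
have sp01 k : sp 0 k = (sp 0 k == 1)%:R.
  have := congr1 (fun M : 'M[C]_n => M k k) Dd.
  rewrite mul_diag_mx !mxE eqxx mulr1n => /eqP.
  rewrite -subr_eq0 -[X in _ - X]mulr1 -mulrBr mulf_eq0 subr_eq0 => /orP[/eqP ->|/eqP ->].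
    by rewrite eq_sym oner_eq0.
  by rewrite eqxx.
exists P, (fun k => sp 0 k == 1); split=> // i j.
rewrite {1}SE -mulmxA mul_diag_mx mxE [RHS]big_mkcond /=; apply: eq_bigr => k _.
rewrite adjmxE mxE; case: eqP => [->|n1]; first by rewrite mul1r.
have -> : sp 0 k = 0 by rewrite sp01; move/eqP/negbTE: n1 => ->.
by rewrite mul0r mulr0.
Qed.

Lemma norm1_mul_diff (a b c d : C) e : norm1 (a - c) <= e -> norm1 (b - d) <= e ->
  norm1 b <= 2 -> norm1 c <= 2 -> norm1 (a * b - c * d) <= 4 * e.
Proof.
move=> h1 h2 hb hc; have -> : a * b - c * d = (a - c) * b + c * (b - d) by ring.
apply: le_trans (norm1D _ _) _.
have := norm1M (a - c) b; have := norm1M c (b - d).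
have := norm1_ge0 (a - c); have := norm1_ge0 (b - d); have := norm1_ge0 b; have := norm1_ge0 c.
by move=> p1 p2 p3 p4 q1 q2; nra.
Qed.

Lemma unitary_approx n (V : 'M[C]_n) e : adj V *m V = 1%:M -> 0 < e ->
  exists W : 'M[C]_n, exists2 mu : C, Num.conj mu * mu = 1 &
    [/\ adj W *m W = 1%:M, forall i j, isQ (W i j) &
        forall i j, norm1 (W i j - mu * V i j) <= e].
Proof.
move=> uV e0; have [mu mu1 uu] := exists_phase V.
have mu0 : mu != 0 by apply: contra_eq_neq mu1 => ->; rewrite mulr0 eq_sym oner_neq0.
(* Chosen so that [1 + nu V = nu (V - mu)], which is invertible. *)
pose nu : C := - Num.conj mu.
have nu1 : Num.conj nu * nu = 1 by rewrite /nu rmorphN /= conjCK mulrNN mulrC.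
have uV' : adj (nu *: V) *m (nu *: V) = 1%:M.
  by rewrite adjmxZ -scalemxAl -scalemxAr scalerA nu1 scale1r.
have u1 : 1%:M + nu *: V \in unitmx.
  have -> : 1%:M + nu *: V = nu *: (V - mu%:M).
    by rewrite scalerBr scale_scalar_mx /nu mulNr mu1 raddfN opprK addrC.
  rewrite unitmxZ // unitfE; apply: contra_eq_neq nu1 => ->.
  by rewrite mulr0 eq_sym oner_neq0.
have [A sA AV] := unitary_cayley uV' u1.
(* The error factor of [cayley_close], plus 1 to keep it positive. *)
pose K : R := 2 * (n%:R * (n%:R * 2 * 2)) + 1.
have K0 : 0 < K by rewrite ltr_wpDl // !mulr_ge0.
have [B [sB qB AB]] := skew_approx sA (divr_gt0 e0 K0).
exists (cayley B), nu => //; split.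
- exact: cayley_unitary.
- exact: isQ_cayley.
move=> i j; have := cayley_close sA sB AB i j; rewrite AV [(nu *: V) i j]mxE => h; apply: le_trans h _.
have -> : 2 * (n%:R * (n%:R * (2 * (e / K)) * 2)) = 2 * (n%:R * (n%:R * 2 * 2)) / K * e by ring.
rewrite ler_piMl ?ltW // ltr_pdivrMr // mul1r /K; lra.
Qed.

(** A whole unitary diagonalising [S] is approximated, and the rows selected by [d] are kept: rows
    of a rational unitary are exactly orthonormal. *)
Lemma rational_frame n (S : 'M[C]_n) e : 0 < e -> adj S = S -> S *m S = S ->
  exists2 F, qframe n F & forall i j : 'I_n, norm1 (S i j - embC (qproj F i j)) <= e.
Proof.
move=> e0 hS iS; have [P [d [PP SE]]] := projection_spectral hS iS.
have uP := mulmx1C PP.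
(* At most [n] rows are summed, each with the factor 4 from [norm1_mul_diff]. *)
pose K : R := n%:R * 4 + 1.
have K0 : 0 < K by rewrite ltr_wpDl // mulr_ge0.
have [W [mu mu1 [uW qW WP]]] := unitary_approx uP (divr_gt0 e0 K0).
have WW := mulmx1C uW.
have Hw (p : 'I_n * 'I_n) : exists q, W p.1 p.2 = embC q by apply: qW.
have [w hw] := choice Hw.
(* Conjugated, since [S i j] sums [conj (P k i) * P k j] while [qproj] conjugates the second
   factor. *)
pose vec k := [seq qconj (w (k, i)) | i <- enum 'I_n].
have vecE k (i : 'I_n) : nth (0, 0) (vec k) i = qconj (w (k, i)).
  by rewrite (nth_map i) ?size_enum_ord // nth_ord_enum.
pose ks := [seq k <- enum 'I_n | d k].
have uks : uniq ks by rewrite filter_uniq ?enum_uniq.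
exists [seq vec k | k <- ks].
  apply/andP; split.
    by apply/allP => _ /mapP[k _ ->]; rewrite size_map size_enum_ord.
  rewrite size_map; apply/allP => i; rewrite mem_iota add0n => /andP[_ hi].
  apply/allP => j; rewrite mem_iota add0n => /andP[_ hj].
  have k0 : 'I_n by move: hi; case: (ks).
  rewrite !(nth_map k0) //; set k := nth _ _ i; set l := nth _ _ j.
  apply/eqP/embC_inj; rewrite embC_nat embC_qdot.
  have -> : (i == j) = (k == l) by rewrite nth_uniq.
  have := congr1 (fun M : 'M[C]_n => M k l) WW; rewrite !mxE => <-.
  apply: eq_bigr => m _; rewrite !vecE !embC_conj conjCK adjmxE.
  by rewrite -(hw (k, m)) -(hw (l, m)).
move=> i j; rewrite embC_qproj big_map big_filter big_enum_cond /= SE -sumrB.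
apply: le_trans (norm1_sum _ _ _) _.
apply: le_trans (_ : \sum_(k < n) 4 * (e / K) <= _); last first.
  rewrite sumr_const card_ord -[_ *+ n]mulr_natl.
  have -> : n%:R * (4 * (e / K)) = n%:R * 4 / K * e by ring.
  rewrite ler_piMl ?ltW // ltr_pdivrMr // mul1r /K; lra.
rewrite [leLHS]big_mkcond; apply: ler_sum => k _.
have K4 : 0 <= 4 * (e / K) by rewrite mulr_ge0 ?divr_ge0 ?ltW.
case: ifP => // _; rewrite !vecE !embC_conj conjCK -(hw (k, i)) -(hw (k, j)) /=.
(* The phase cancels here. *)
have -> : Num.conj (P k i) * P k j = Num.conj (mu * P k i) * (mu * P k j).
  by rewrite rmorphM /= mulrACA mu1 mul1r.
have uM : adj (mu *: P) *m (mu *: P) = 1%:M.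
  by rewrite adjmxZ -scalemxAl -scalemxAr scalerA mu1 scale1r.
rewrite -norm1N opprB; apply: norm1_mul_diff => //.
- by rewrite -rmorphB /= norm1_conj.
- exact: unitary_bound.
- by rewrite norm1_conj; have := unitary_bound uM k i; rewrite mxE.
Qed.
End RationalFrames.

(* (q s)^2 (X - x) (X - conj x) for x = p/q + i r/s, lowest degree first. *)
Definition minpolyQ (x : rat * rat) : seq int :=
  let p := numq x.1 in let q := denq x.1 in let r := numq x.2 in let s := denq x.2 in
  [:: (p * s) * (p * s) + (r * q) * (r * q); - ((p * q) * (s * s) + (p * q) * (s * s));
      (q * s) * (q * s)].

(** The isolating box is the point itself, so no separation of roots is needed. *)
Definition codeQ (x : rat * rat) : nat :=
  pickle (minpolyQ x, (x.1, x.1, x.2, x.2)).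

Definition codeF (F : seq (seq (rat * rat))) : nat := pickle (map (map codeQ) F).

Lemma computable_codeF : computable codeF.
Proof. by rewrite /codeF /codeQ /minpolyQ; comp. Qed.

(** An accepted entry is off by at most four tolerances. The trace then errs by less than 1 if
    [4 < D]. In [tr (rho S)], [4^n] products with entries of [rho] bounded by 2 err by at most
    [8 / D] in total. *)
Definition tolerance (D n : nat) : rat := (D * 8 ^ n)%:R^-1.

(** Besides the family, [w] carries the grid fineness used for all entries, so that one search finds
    both. *)
Definition frame_test (D : nat) (c : nat * seq (seq nat)) (w : seq (seq (rat * rat)) * nat) : bool :=
  qframe (2 ^ c.1)%N w.1 &&
  all (fun i => all (fun j =>
    near_root (nth 0%N (nth [::] c.2 i) j) (qproj w.1 i j) (tolerance D c.1) w.2)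
      (iota 0 (2 ^ c.1))) (iota 0 (2 ^ c.1)).

Lemma computable_frame_test D : computable (fun p => frame_test D p.1 p.2).
Proof.
have cn (A : countType) (f : A -> nat * (rat * rat) * rat * nat) :
    computable f -> computable (fun a => near_root (f a).1.1.1 (f a).1.1.2 (f a).1.2 (f a).2).
  by move=> cf; apply: (computable_comp computable_near_root cf).
rewrite /frame_test /qframe /qdot /qproj /tolerance; comp.
apply: (cn _ (fun p : (nat * seq (seq nat) * (seq (seq (rat * rat)) * nat)) * nat * nat =>
  (nth 0%N (nth [::] p.1.1.1.2 p.1.2) p.2, 
   foldr (fun v r => qadd (qmul (nth (0, 0) v p.1.2) (qconj (nth (0, 0) v p.2))) r) (0, 0) p.1.1.2.1,
   ((D * 8 ^ p.1.1.1.1)%:R^-1 : rat), p.1.1.2.2))).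
comp.
Qed.

(** * Rank and weight of an accepted family *)

Section Frames.
Variable R : realType.
Local Notation C := (complex R).
Local Notation embC := (embC R).

Lemma codesAlg_codeQ x : codesAlg (codeQ x) (embC x).
Proof.
exists (minpolyQ x), x.1, x.1, x.2, x.2; split; first by rewrite /codeQ pickleK.
rewrite -/(polyZ R (minpolyQ x)) /=; split; try by rewrite !lexx.
- apply/eqP => /(congr1 (fun p : {poly C} => p`_2)); rewrite coef0 coef_Poly /= => /eqP.
  by rewrite intr_eq0 !mulf_eq0 !denq_eq0.
- apply/rootP; rewrite /minpolyQ !polyZ_cons /polyZ horner_Poly /=.
  have nE (q : rat) : (numq q)%:~R = ratr q * (denq q)%:~R :> R.
    by rewrite -(ratr_int R (numq q)) -(ratr_int R (denq q)) -rmorphM /= numqE.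
  rewrite !complex_int !(rmorphD, rmorphM, rmorphN) /= !nE /embC.
  case: x => a b /=; set p := ratr a; set q := ratr b; set d := (denq a)%:~R; set e := (denq b)%:~R.
  by apply/eqP; rewrite eq_complex /=; apply/andP; split; apply/eqP; ring.
- move=> [u v] _ /= h1 h2; rewrite /embC.
  by congr Complex; apply/eqP; rewrite eq_le andbC.
Qed.

Lemma algebraicC_embC x : algebraicC (embC x).
Proof.
pose p : {poly rat} := 'X^2 - (2 * x.1) *: 'X + (x.1 ^+ 2 + x.2 ^+ 2)%:P.
exists p; split.
  apply/eqP => /(congr1 (fun p : {poly rat} => p`_2)).
  by rewrite coef0 !coefE /= mulr0 subr0 addr0 => /eqP; rewrite oner_eq0.
have rC (q : rat) : ratr q = Complex (ratr q : R) 0 :> C.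
  by rewrite -[LHS](fmorph_rat (real_complex R)).
have E (c d : rat) (z : C) :
    (map_poly ratr ('X^2 - c *: 'X + d%:P)).[z] = z ^+ 2 - ratr c * z + ratr d.
  by rewrite rmorphD rmorphB /= map_polyZ map_polyXn map_polyX map_polyC !hornerE.
apply/rootP; rewrite E !rC /embC; case: x {p} => a b /=.
have -> : ratr (2 * a) = 2 * ratr a :> R by rewrite rmorphM /= ratr_nat.
have -> : ratr (a ^+ 2 + b ^+ 2) = ratr a ^+ 2 + ratr b ^+ 2 :> R.
  by rewrite rmorphD /= !rmorphXn.
by apply/eqP; rewrite eq_complex /=; apply/andP; split; apply/eqP; ring.
Qed.

Definition frame_vecs N (F : seq (seq (rat * rat))) : seq 'cV[C]_N :=
  [seq \col_i embC (nth (0, 0) v i) | v <- F].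

Lemma nth_frame_vecs N F i j : (i < size F)%N ->
  (nth 0 (frame_vecs N F) i) j 0 = embC (nth (0, 0) (nth [::] F i) j).
Proof. by move=> hi; rewrite (nth_map [::]) // mxE. Qed.

Lemma frame_vecs_algebraic N F v : v \in frame_vecs N F -> forall i, algebraicC (v i 0).
Proof. by move=> /mapP[w _ ->] i; rewrite mxE; apply: algebraicC_embC. Qed.

Lemma frame_orthonormal N F : qframe N F -> Defs.orthonormal (frame_vecs N F).
Proof.
move=> /andP[_ /allP oF] i j; rewrite size_map => hi hj.
have := oF i; rewrite mem_iota add0n => /(_ hi)/allP/(_ j); rewrite mem_iota add0n => /(_ hj) /eqP.
move/(congr1 embC); rewrite embC_qdot embC_nat => <-; rewrite mxE.
by apply: eq_bigr => k _; rewrite adjmxE !nth_frame_vecs.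
Qed.

Lemma codesVecs_codeF n F : qframe (2 ^ n) F -> codesVecs (codeF F) (frame_vecs (2 ^ n) F).
Proof.
move=> /andP[/allP sF _]; exists (map (map codeQ) F).
split; first exact: pickleK.
rewrite !size_map; split => // i hi; rewrite (nth_map [::]) // size_map.
have /eqP si : size (nth [::] F i) == (2 ^ n)%N by apply: sF; rewrite mem_nth.
split=> // j; rewrite (nth_map (0, 0)) ?si // nth_frame_vecs //.
exact: codesAlg_codeQ.
Qed.

Lemma mxtraceB N (A B : 'M[C]_N) : \tr (A - B) = \tr A - \tr B.
Proof. exact: raddfB. Qed.

Definition projF N F : 'M[C]_N := \matrix_(i, j) embC (qproj F i j).

Lemma frame_weight N F (rho : 'M[C]_N) :
  \sum_(v <- frame_vecs N F) complex.Re ((adj v *m rho *m v) 0 0) =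
  complex.Re (\tr (rho *m projF N F)).
Proof.
have -> : projF N F = \sum_(v <- frame_vecs N F) v *m adj v.
  rewrite big_map; apply/matrixP => i j; rewrite mxE embC_qproj summxE.
  by apply: eq_bigr => v _; rewrite mxE big_ord1 adjmxE !mxE.
rewrite mulmx_sumr (raddf_sum (@mxtrace C N)) /= Re_sum; apply: eq_bigr => v _.
by rewrite mulmxA mxtrace_mulC mulmxA /mxtrace big_ord1.
Qed.

Lemma tr_projF N F : qframe N F -> complex.Re (\tr (projF N F)) = (size F)%:R.
Proof.
move=> qF; rewrite -[projF N F]mul1mx -frame_weight big_seq.
rewrite (eq_bigr (fun=> 1)); last first.
  move=> v vF; rewrite mulmx1; have vi : (index v (frame_vecs N F) < size F)%N.
    by rewrite -(size_map (fun v => \col_i embC (nth (0, 0) v i) : 'cV[C]_N)) index_mem.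
  have := frame_orthonormal qF; rewrite /Defs.orthonormal size_map => /(_ _ _ vi vi).
  by rewrite nth_index // eqxx => ->.
by rewrite -big_seq big_const_seq count_predT size_map iter_addr_0.
Qed.

(** In a full-rank factorisation [S = L K], idempotence cancels to [K L = 1], whose trace is the
    rank. *)
Lemma tr_idempotent N (S : 'M[C]_N) : S *m S = S -> \tr S = (\rank S)%:R.
Proof.
have gen r (L : 'M[C]_(N, r)) (K : 'M[C]_(r, N)) T : row_full L -> row_free K ->
    L *m K = T -> T *m T = T -> \tr T = r%:R.
  move=> /row_fullP [L' L'L] /row_freeP [K' KK'] <- iT.
  suff KL : K *m L = 1%:M by rewrite mxtrace_mulC KL mxtrace1.
  have := congr1 (fun X => L' *m X *m K') iT.
  by rewrite !mulmxA L'L mul1mx -!mulmxA KK' mulmx1.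
exact: gen (col_base_full S) (row_base_free S) (mulmx_base S).
Qed.

(** Positivity on [e_i + c e_j] for [c] among 1, -1, i, -i bounds the real and imaginary parts of
    [rho i j] by the mean of two diagonal entries, which are at most 1. *)
Lemma density_bound N (rho : 'M[C]_N) : is_density rho -> forall i j, norm1 (rho i j) <= 2.
Proof.
move=> [hr pos tr1].
have Q i j (c : C) : 0 <= complex.Re (rho i i + c * rho i j + Num.conj c * rho j i + Num.conj c * c * rho j j).
  have := pos (delta_mx i 0 + c *: delta_mx j 0).
  have ad k : adj (delta_mx k 0 : 'cV[C]_N) = delta_mx 0 k.
    by rewrite /adj map_delta_mx trmx_delta.
  have E k l : (delta_mx (0 : 'I_1) k *m rho *m delta_mx l (0 : 'I_1)) 0 0 = rho k l.
    by rewrite -rowE -colE !mxE.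
  have addE (A B : 'M[C]_1) : (A + B) 0 0 = A 0 0 + B 0 0 by rewrite mxE.
  have scE (k : C) (A : 'M[C]_1) : (k *: A) 0 0 = k * A 0 0 by rewrite mxE.
  rewrite adjmxD adjmxZ !ad !(mulmxDl, mulmxDr, =^~ scalemxAl, =^~ scalemxAr) !(addE, scE, E).
  by congr (0 <= complex.Re _); ring.
have d0 i : 0 <= complex.Re (rho i i).
  by have := Q i i 0; rewrite rmorph0 !mul0r !addr0.
have d1 i : complex.Re (rho i i) <= 1.
  have := congr1 (@complex.Re R) tr1; rewrite /mxtrace Re_sum (bigD1 i) //= => <-.
  by rewrite lerDl sumr_ge0.
move=> i j.
have hji : rho j i = Num.conj (rho i j) by rewrite -{1}hr adjmxE.
have := Q i j 1; have := Q i j (-1); have := Q i j 'i%C; have := Q i j (- 'i%C).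
have := d1 i; have := d1 j.
rewrite hji /norm1; case: (rho i j) => a b; case: (rho i i) => a1 b1; case: (rho j j) => a2 b2 /=.
move=> ? ? ? ? ? ?.
have : `|a| <= 1 by rewrite ler_norml; apply/andP; split; lra.
have : `|b| <= 1 by rewrite ler_norml; apply/andP; split; lra.
by lra.
Qed.

Section Sound.
Variables (n D : nat) (S : 'M[C]_(2 ^ n)) (rows : seq (seq nat)).
Variables (w : seq (seq (rat * rat)) * nat).
Hypotheses (D0 : (4 < D)%N)
  (cE : forall i j : 'I_(2 ^ n), codesAlg (nth 0 (nth [::] rows i) j) (S i j))
  (iS : S *m S = S) (tst : frame_test D (n, rows) w).

Let F := w.1.

Lemma frame_close i j : norm1 (S i j - projF (2 ^ n) F i j) <= 4 / (D%:R * 8 ^+ n).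
Proof.
have /andP[_ /allP/(_ (val i))] := tst; rewrite mem_iota add0n => /(_ (ltn_ord i))/allP/(_ (val j)).
rewrite mem_iota add0n => /(_ (ltn_ord j)) /(near_root_sound (cE i j)) [].
rewrite /norm1 ReB ImB mxE rmorphM /= /tolerance fmorphV /= !rmorph_nat natrM natrX.
by set a := `|_|; set b := `|_|; set c := (_ * _)^-1; lra.
Qed.

Lemma frame_size : complex.Re (\tr S) = (size F)%:R.
Proof.
have [qF _] := andP tst.
rewrite tr_idempotent // -(rmorph_nat (real_complex R)) /=.
suff : `|(\rank S)%:R - (size F)%:R : R| < 1.
  rewrite ltr_norml => /andP[h1 h2]; congr _%:R.
  have l1 : (\rank S < (size F).+1)%N by rewrite -(ltr_nat R) -natr1; lra.
  have l2 : (size F < (\rank S).+1)%N by rewrite -(ltr_nat R) -natr1; lra.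
  by apply: anti_leq; apply/andP.
have -> : (\rank S)%:R - (size F)%:R = complex.Re (\tr (S - projF (2 ^ n) F)).
  rewrite mxtraceB ReB (tr_projF qF) tr_idempotent //.
  by rewrite -[X in complex.Re X](rmorph_nat (real_complex R)).
have D0' : 0 < D%:R :> R by rewrite ltr0n; apply: leq_trans D0.
have p8 : 0 < 8 ^+ n :> R by rewrite exprn_gt0.
apply: le_lt_trans (_ : norm1 (\tr (S - projF (2 ^ n) F)) < 1).
  by rewrite /norm1 lerDl.
apply: le_lt_trans (norm1_sum _ _ _) _.
apply: le_lt_trans (_ : \sum_(i < 2 ^ n) 4 / (D%:R * 8 ^+ n) < 1).
  by apply: ler_sum => i _; have := frame_close i i; rewrite !mxE.
rewrite sumr_const card_ord -[_ *+ _]mulr_natl natrX mulrA ltr_pdivrMr ?mulr_gt0 // mul1r mulrC.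
have h1 : 2 ^+ n <= 8 ^+ n :> R by rewrite lerXn2r ?nnegrE ?ler_nat.
have h2 : 4 < D%:R :> R by rewrite ltr_nat.
by nra.
Qed.

Lemma frame_weight_close (rho : 'M[C]_(2 ^ n)) : is_density rho ->
  complex.Re (\tr (rho *m S)) - 8 / D%:R <=
  \sum_(v <- frame_vecs (2 ^ n) F) complex.Re ((adj v *m rho *m v) 0 0).
Proof.
move=> hr; rewrite frame_weight lerBlDr -lerBlDl -ReB -mxtraceB -mulmxBr.
apply: le_trans (_ : norm1 (\tr (rho *m (S - projF (2 ^ n) F))) <= _).
  by rewrite /norm1; apply: le_trans (ler_norm _) _; rewrite lerDl.
apply: le_trans (norm1_sum _ _ _) _.
have D0' : 0 < D%:R :> R by rewrite ltr0n; apply: leq_trans D0.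
have p8 : 0 < 8 ^+ n :> R by rewrite exprn_gt0.
apply: le_trans (_ : \sum_(i < 2 ^ n) (2 ^ n)%:R * (2 * (4 / (D%:R * 8 ^+ n))) <= _).
  apply: ler_sum => i _; apply: mulmx_bound; first exact: density_bound.
  by move=> k l; have := frame_close k l; rewrite !mxE.
rewrite sumr_const card_ord -[_ *+ _]mulr_natl !natrX.
have -> : 8 / D%:R = 8 ^+ n * (2 * (4 / (D%:R * 8 ^+ n))) :> R.
  by field; rewrite !gt_eqF.
have i0 : 0 < (D%:R * 8 ^+ n : R)^-1 by rewrite invr_gt0 mulr_gt0.
rewrite mulrA; apply: ler_wpM2r; first by lra.
have -> : 2 ^+ n * 2 ^+ n = 4 ^+ n :> R by rewrite -exprMn -natrM.
by rewrite lerXn2r ?nnegrE ?ler_nat.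
Qed.
End Sound.

Lemma frame_test_complete n D (S : 'M[C]_(2 ^ n)) rows : (0 < D)%N ->
  (forall i j : 'I_(2 ^ n), codesAlg (nth 0 (nth [::] rows i) j) (S i j)) ->
  adj S = S -> S *m S = S -> exists w, frame_test D (n, rows) w.
Proof.
move=> D0 cE hS iS.
have t0 : 0 < tolerance D n by rewrite invr_gt0 ltr0n muln_gt0 D0 expn_gt0.
have t0' : 0 < ratr (tolerance D n) / 2 :> R by rewrite divr_gt0 ?ltr0q.
have [F qF FS] := rational_frame t0' hS iS.
have H (p : 'I_(2 ^ n) * 'I_(2 ^ n)) : exists M0, forall M, (M0 <= M)%N ->
    near_root (nth 0%N (nth [::] rows p.1) p.2) (qproj F p.1 p.2) (tolerance D n) M.
  apply: (near_root_complete (cE p.1 p.2)) => //; have := FS p.1 p.2; rewrite /norm1 ReB ImB /=;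
   by apply: le_trans; rewrite ?lerDl ?lerDr.
have [f hf] := choice H.
(* Each entry is certified at every fineness beyond its own threshold, so the maximum serves all
   entries. *)
exists (F, \max_p f p); apply/andP; split => //=.
apply/allP => i; rewrite mem_iota add0n => /andP[_ hi].
apply/allP => j; rewrite mem_iota add0n => /andP[_ hj].
exact: (hf (Ordinal hi, Ordinal hj) _ (leq_bigmax _)).
Qed.
End Frames.

(** * A prefix-free machine *)

Section Words.
Local Open Scope nat_scope.

(* The [l] low-order binary digits of [m], most significant first. *)
Definition bits (l m : nat) : seq bool :=
  nat_rect (fun=> seq bool) [::] (fun i s => odd (m %/ 2 ^ i) :: s) l.

Fixpoint bval (s : seq bool) : nat := if s is b :: s' then b * 2 ^ size s' + bval s' else 0.

Definition word (k l m : nat) : seq bool := nseq k false ++ true :: bits l m.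

Lemma size_bits l m : size (bits l m) = l.
Proof. by elim: l => //= l ->. Qed.

Lemma bval_lt s : bval s < 2 ^ size s.
Proof. by elim: s => //= b s IH; rewrite expnS; case: b; lia. Qed.

Lemma bval_cat s t : bval (s ++ t) = bval s * 2 ^ size t + bval t.
Proof.
by elim: s => //= b s ->; rewrite size_cat expnD mulnDl mulnA addnA.
Qed.

Lemma bval_bits l m : m < 2 ^ l -> bval (bits l m) = m.
Proof.
move=> ml; suff -> : bval (bits l m) = m %% 2 ^ l by rewrite modn_small.
elim: l {ml} => [|l IH] /=; first by rewrite modn1.
rewrite size_bits IH; set q := m %/ 2 ^ l.
have mE : m = q./2 * 2 ^ l.+1 + (odd q * 2 ^ l + m %% 2 ^ l).
  rewrite {1}(divn_eq m (2 ^ l)) -/q -{1}(odd_double_half q) expnS -muln2; lia.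
have p2 : 0 < 2 ^ l by rewrite expn_gt0.
rewrite [in RHS]mE modnMDl [RHS]modn_small //.
rewrite expnS mul2n -addnn -addnS leq_add ?ltn_pmod //.
by case: (odd q); rewrite ?mul1n.
Qed.

Lemma word_prefix k l m k' l' m' t : word k l m ++ t = word k' l' m' ->
  k = k' /\ bits l m ++ t = bits l' m'.
Proof.
rewrite /word -catA /=.
elim: k k' => [|k IH] [|k'] //=; first by case.
by case=> /IH [-> ->].
Qed.

Lemma size_word k l m : size (word k l m) = (k + l).+1.
Proof. by rewrite size_cat size_nseq /= size_bits addnS. Qed.
End Words.

(** * Disjoint intervals and the dyadic words naming them *)

Section Machine.
Variables (tau : nat -> rat) (N out : nat -> nat).
Hypotheses (ctau : computable tau) (cN : computable N) (cout : computable out).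
Hypothesis tau_ge0 : forall j, 0 <= tau j.
Hypothesis tailN : forall k r, (4 ^ k)%:R * \sum_(N k <= j < r) tau j <= 1.

Definition csum (a r : nat) : rat := foldr (fun j x => tau j + x) 0 (iota a (r - a)).

Lemma csumE a r : csum a r = \sum_(a <= j < r) tau j.
Proof.
rewrite /csum /index_iota; elim: (iota _ _) => [|j s IH] /=; first by rewrite big_nil.
by rewrite big_cons IH.
Qed.

Lemma computable_csum (A : countType) (f g : A -> nat) : computable f -> computable g ->
  computable (fun a => csum (f a) (g a)).
Proof.
move=> cf cg; rewrite /csum; comp.
by apply: (@computable_comp _ _ _ tau (fun p : A * (nat * rat) => p.2.1)); comp.
Qed.

(** A tuple [(k, (r, (l, m)))]: tail [k], index [r] in it, and the dyadic cell from [m / 2^l] to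
    [(m + 1) / 2^l]. *)
Definition request := (nat * (nat * (nat * nat)))%type.

(** The interval of [r] has length [w = 4^k tau r]. The condition [2 <= w 2^l] leaves room for a
    full cell starting at the first multiple of [2^-l] not below the left end; [w 2^l < 4] keeps
    words short and determines [l]. *)
Definition accepts (sigma : seq bool) (q : request) : bool :=
  let: (k, (r, (l, m))) := (q.1, (q.2.1, (q.2.2.1, q.2.2.2))) in
  [&& (N k <= r)%N, 2 <= (4 ^ k)%:R * tau r * (2 ^ l)%:R, (4 ^ k)%:R * tau r * (2 ^ l)%:R < 4,
      (4 ^ k)%:R * csum (N k) r * (2 ^ l)%:R <= m%:R,
      m%:R < (4 ^ k)%:R * csum (N k) r * (2 ^ l)%:R + 1 & sigma == word k l m].

(** Rounding up the left end loses less than one unit of [2^-l], and the interval is at least two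
    units long, so the cell fits. By [tailN] it stays within the unit interval, so [l] digits
    suffice for [m]. *)
Lemma accepts_interval sigma q : accepts sigma q ->
  let c r := (4 ^ q.1)%:R * csum (N q.1) r in let l := q.2.2.1 in let m := q.2.2.2 in
  [/\ c q.2.1 * (2 ^ l)%:R <= m%:R, m.+1%:R <= c q.2.1.+1 * (2 ^ l)%:R & (m < 2 ^ l)%N].
Proof.
case: q => k [r [l m]] /and5P[/= Nr h2 h4 cm /andP[mc _]].
have cS : csum (N k) r.+1 = csum (N k) r + tau r by rewrite !csumE big_nat_recr.
have h : m.+1%:R <= (4 ^ k)%:R * csum (N k) r.+1 * (2 ^ l)%:R.
  rewrite cS -natr1 mulrDr mulrDl; lra.
split=> //; rewrite -(ler_nat rat); apply: le_trans h _.
by rewrite ler_piMl // csumE.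
Qed.

Lemma csum_mono a r r' : (a <= r <= r')%N -> csum a r <= csum a r'.
Proof.
case/andP=> ar rr'; rewrite !csumE (big_cat_nat ar rr') /= lerDl sumr_ge0 //.
Qed.

(** The marker gives the same [k], and the cell of the longer word lies in that of the shorter one.
    Its left end [x] is thus in the intervals of [r] and [r'], which are disjoint unless [r = r'].
    Then a nonempty [t] would at least double [w 2^l], from 2 or more to 4 or more. The equality of
    [r] also makes the output independent of the accepted request that is found. *)
Lemma accepts_prefix sigma t q q' : accepts sigma q -> accepts (sigma ++ t) q' ->
  t = [::] /\ q.2.1 = q'.2.1.
Proof.
move=> a1 a2; have [i1 j1 s1] := accepts_interval a1; have [i2 j2 s2] := accepts_interval a2.
case: q q' a1 a2 i1 j1 s1 i2 j2 s2 => k [r [l m]] [k' [r' [l' m']]] /=.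
move=> /and5P[/= Nr h2 h4 _ /andP[_ /eqP ->]] /and5P[/= Nr' h2' h4' _ /andP[_ /eqP]].
move=> /word_prefix [ek]; rewrite -{k'}ek in Nr' h2' h4' *.
move=> eb i1 j1 s1 i2 j2 s2.
have el : (l' = l + size t)%N by rewrite -(size_bits l' m') -eb size_cat size_bits.
have em : (m' = m * 2 ^ size t + bval t)%N.
  by rewrite -[LHS](bval_bits s2) -eb bval_cat bval_bits.
have bt := bval_lt t.
pose x : rat := m'%:R / (2 ^ l')%:R.
have p0 : 0 < (2 ^ l)%:R :> rat by rewrite ltr0n expn_gt0.
have p0' : 0 < (2 ^ l')%:R :> rat by rewrite ltr0n expn_gt0.
have E : (2 ^ l')%:R = (2 ^ l)%:R * (2 ^ size t)%:R :> rat by rewrite el expnD natrM.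
have pt : 0 < (2 ^ size t)%:R :> rat by rewrite ltr0n expn_gt0.
have x1 : m%:R / (2 ^ l)%:R <= x.
  rewrite /x ler_pdivlMr // E mulrA mulfVK ?gt_eqF // -natrM ler_nat em leq_addr //.
have x2 : x < m.+1%:R / (2 ^ l)%:R.
  rewrite /x ltr_pdivrMr // E mulrA mulfVK ?gt_eqF // -natrM ltr_nat em mulSn addnC ltn_add2r //.
set cc := fun r => (4 ^ k)%:R * csum (N k) r.
have y1 : cc r <= x by apply: le_trans x1; rewrite ler_pdivlMr.
have y2 : x < cc r.+1 by apply: lt_le_trans x2 _; rewrite ler_pdivrMr.
have y1' : cc r' <= x by rewrite ler_pdivlMr.
have y2' : x < cc r'.+1.
  by apply: lt_le_trans (_ : m'.+1%:R / (2 ^ l')%:R <= _); rewrite ?ler_pdivrMr // ltr_pM2r ?invr_gt0 // ltr_nat.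
have mono a b : (N k <= a <= b)%N -> cc a <= cc b.
  by move=> h; rewrite ler_wpM2l // csum_mono.
have rr : r = r'.
  case: (ltngtP r r') => // lt.
    have h : cc r.+1 <= cc r' by apply: mono; rewrite lt leqW.
    by have := lt_le_trans y2 (le_trans h y1'); rewrite ltxx.
  have h : cc r'.+1 <= cc r by apply: mono; rewrite lt leqW.
  by have := lt_le_trans y2' (le_trans h y1); rewrite ltxx.
split=> //; rewrite -rr in h2' h4'.
case: t {eb em bt} el E pt => // b t el E pt.
have h5 : 2 <= (2 ^ size (b :: t))%:R :> rat.
  by rewrite (ler_nat _ 2) /= expnS leq_pmulr // expn_gt0.
rewrite E mulrA in h4'.
by have := le_lt_trans (ler_pM (ler0n _ 2) (ler0n _ 2) h2 h5) h4'; rewrite -natrM ltr_nat.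
Qed.

Lemma computable_accepts : computable (fun p : seq bool * request => accepts p.1 p.2).
Proof.
have cN' (A : countType) (f : A -> nat) : computable f -> computable (fun a => N (f a)).
  exact: computable_comp.
have ct' (A : countType) (f : A -> nat) : computable f -> computable (fun a => tau (f a)).
  exact: computable_comp.
rewrite /accepts /word /bits; comp.
all: repeat first
  [ lazymatch goal with
    | |- computable (fun a => N (@?f a)) => apply: (cN' _ f)
    | |- computable (fun a => tau (@?f a)) => apply: (ct' _ f)
    | |- computable (fun a => csum (@?f a) (@?g a)) => apply: (@computable_csum _ f g)
    end
  | comp_step].
Qed.

Lemma accepts_exists k r : (N k <= r)%N -> 0 < tau r ->
  exists l m, accepts (word k l m) (k, (r, (l, m))).
Proof.
move=> Nr tr.
pose w := (4 ^ k)%:R * tau r.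
have w0 : 0 < w by rewrite mulr_gt0 // ltr0n expn_gt0.
have w1 : w <= 1.
  apply: le_trans (tailN k r.+1); rewrite ler_wpM2l // big_nat_recr //= lerDr sumr_ge0 //.
have ex : exists l, 2 <= w * (2 ^ l)%:R.
  exists (Num.truncn (2 / w)).+1; rewrite mulrC -ler_pdivrMr //.
  apply: le_trans (ltW (truncnS_gt (2 / w))) _.
  by rewrite ler_nat ltnW // ltn_expl.
have [l hl lmin] := ex_minnP ex.
have hl4 : w * (2 ^ l)%:R < 4.
  (* Minimality of [l] gives the upper bound; for [l = 0] it comes from [w <= 1]. *)
  case: l hl lmin => [|l] hl lmin; first by rewrite mulr1; lra.
  have : ~~ (2 <= w * (2 ^ l)%:R) by apply/negP => /lmin; rewrite ltnn.
  by rewrite -ltNge expnS natrM; lra.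
pose y := (4 ^ k)%:R * csum (N k) r * (2 ^ l)%:R.
have y0 : 0 <= y by rewrite !mulr_ge0 // csumE sumr_ge0.
have [m hm] : exists m : nat, y <= m%:R < y + 1.
  have ey : exists m : nat, y <= m%:R.
    by exists (Num.truncn y).+1; apply: ltW; exact: truncnS_gt.
  have [m hm mmin] := ex_minnP ey; exists m; rewrite hm /=.
  case: m hm mmin => [|m] hm mmin; first by lra.
  have : ~~ (y <= m%:R) by apply/negP => /mmin; rewrite ltnn.
  by rewrite -ltNge -natr1; lra.
exists l, m; case/andP: hm => h1 h2.
by rewrite /accepts /= Nr hl hl4 h1 h2 eqxx.
Qed.

Definition dreq (t : nat) : request := odflt (0, (0, (0, 0)))%N (unpickle t).

(** On [sigma] the machine searches for a request accepted with [sigma], so it halts only on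
    accepted words. As [sigma] has [k + l + 1] bits, [2^(|sigma| + k) tau r] is
    [2 * 4^k * 2^l * tau r], below 8 by the last bound on [l]. *)
Lemma prefix_free_machine : exists2 M, prefix_free M &
  forall k r, (N k <= r)%N -> 0 < tau r ->
  exists2 sigma, runs M sigma (out r) & (2 ^ (size sigma + k))%:R * tau r < 8.
Proof.
have cdreq (A : countType) (f : A -> nat) : computable f -> computable (fun a => dreq (f a)).
  apply: computable_unpickle; do 3 (apply: decodable_pair; first exact: decodable_nat).
  exact: decodable_nat.
have [en hn] := comp1_sub (comp1_const 1) comp1_id.
have [ec hc] := comp1_cons comp1_fst (comp1_cons comp1_snd (comp1_const 0)).
have [ea ha] : computable (fun p : seq bool * nat => accepts p.1 (dreq p.2)).
  apply: (@computable_comp _ _ _ (fun p : seq bool * request => accepts p.1 p.2)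
    (fun p : seq bool * nat => (p.1, dreq p.2)) computable_accepts).
  by apply: computable_pair; [|apply: cdreq]; comp.
have [eo ho] : computable (fun t => out (dreq t).2.1).
  apply: (computable_comp cout).
  by apply: computable_fst; apply: computable_snd; apply: cdreq; comp.
pose chk := pComp en (pComp ea ec).
have hchk sigma t : eval noOracle chk (npair (pickle sigma) t) (~~ accepts sigma (dreq t)).
  apply: (@ev_comp _ _ _ _ (accepts sigma (dreq t))); last first.
    by have := hn (accepts sigma (dreq t)); case: (accepts _ _).
  apply: ev_comp (hc _) _; rewrite !npairK; exact: (ha (sigma, t)).
pose M := pComp eo (pMin chk).
have haltsP sigma : halts M sigma -> exists q, accepts sigma q.
  move=> [y h]; inversion h as [| | | | | |? ? ? t ? hmin _| | |]; subst.
  inversion hmin as [| | | | | | | | |? ? ? k h0 _]; subst.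
  exists (dreq t); have := eval_functional (hchk sigma t) h0.
  by case: (accepts _ _).
exists M.
  move=> sigma t /haltsP[q a1] /haltsP[q' a2].
  by have [] := accepts_prefix a1 a2.
move=> k r Nr tr; have [l [m acc]] := accepts_exists Nr tr.
exists (word k l m).
  have ex : exists t, accepts (word k l m) (dreq t).
    by exists (pickle (k, (r, (l, m)))); rewrite /dreq pickleK.
  have [t at_ tmin] := ex_minnP ex.
  (* The search may stop at another request for the same word, but its index is still [r]. *)
  have rE : (dreq t).2.1 = r.
    by rewrite -{1}[word k l m]cats0 in acc; have [_ /= ->] := accepts_prefix at_ acc.
  rewrite /runs -rE; apply: (@ev_comp _ _ _ _ t); last exact: (ho t).
  apply: (@ev_min _ _ _ _ (fun=> 0%N)); first by have := hchk (word k l m) t; rewrite at_.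
  move=> j jt; have := hchk (word k l m) j; case: (boolP (accepts _ _)) => // /tmin.
  by rewrite leqNgt jt.
case/and5P: acc => _ _ /= h4 _ _.
have -> : (2 ^ (size (word k l m) + k))%:R = 2 * ((4 ^ k)%:R * (2 ^ l)%:R) :> rat.
  have -> : (4 ^ k = 2 ^ (2 * k))%N by rewrite expnM.
  by rewrite size_word -!natrM -!expnD -expnS; congr (_ ^ _)%:R; lia.
lra.
Qed.
End Machine.

(** * Passing the test *)

(** Replaces the algebraic projections by computable rational data. [F r] comes from the first
    accepted witness for the code of [S r], and since its size is the exact rank, [tau(S r)] becomes
    a computable rational. *)
Lemma test_frames (R : realType) (S : nat -> {n : nat & 'M[complex R]_(2 ^ n)}) (D : nat) :
  (4 < D)%N -> computable_proj_seq S -> (forall m, is_special_projection (projT2 (S m))) ->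
  exists F : nat -> seq (seq (rat * rat)), [/\ computable F, computable (fun r => projT1 (S r)) &
    forall r, [/\ qframe (2 ^ projT1 (S r)) (F r),
      tauS (S r) = ratr ((size (F r))%:R * (2 ^ projT1 (S r))%:R^-1) &
      forall rho : forall n, 'M[complex R]_(2 ^ n), is_density (rho (projT1 (S r))) ->
      rhoS rho (S r) - 8 / D%:R <= \sum_(v <- frame_vecs R (2 ^ projT1 (S r)) (F r))
         complex.Re ((adj v *m rho (projT1 (S r)) *m v) 0 0)]].
Proof.
move=> D4 [e /choice [c hc]] spS.
have cc : computable c by exists e => m; case: (hc m).
pose meta r : nat * seq (seq nat) := odflt (0%N, [::]) (unpickle (c r)).
have cmeta : computable meta.
  apply: computable_unpickle cc; apply: decodable_pair; first exact: decodable_nat.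
  by do 2 apply: decodable_seq; exact: decodable_nat.
have metaE r : meta r = (projT1 (S r), (meta r).2) /\ forall i j : 'I_(2 ^ projT1 (S r)),
    codesAlg (nth 0%N (nth [::] (meta r).2 i) j) (projT2 (S r) i j).
  have [_ [rows [uE [_ cE]]]] := hc r; rewrite /meta uE /=; split=> // i j.
  by have [] := cE i j.
pose dwit j : seq (seq (rat * rat)) * nat := odflt ([::], 0%N) (unpickle j).
have H r : exists j, frame_test D (meta r) (dwit j).
  have [-> cE] := metaE r; have [hS iS _] := spS r.
  have [|w hw] := frame_test_complete _ cE hS iS (D := D); first exact: leq_trans D4.
  by exists (pickle w); rewrite /dwit pickleK.
have cdwit (A : countType) (f : A -> nat) : computable f -> computable (fun a => dwit (f a)).
  apply: computable_unpickle; apply: decodable_pair; last exact: decodable_nat.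
  by do 2 apply: decodable_seq; apply: decodable_pair; exact: decodable_rat.
pose F r := (dwit (ex_minn (H r))).1.
exists F; split.
- rewrite /F; comp; apply: (cdwit); comp.
  apply: (@computable_comp _ _ _ (fun p => frame_test D p.1 p.2)
    (fun p : nat * nat => (meta p.1, dwit p.2)) (computable_frame_test D)).
  by apply: computable_pair; [apply: (computable_comp cmeta)|apply: (cdwit)]; comp.
- apply: (@computable_ext _ _ (fun r => (meta r).1)) => [r|]; first by have [->] := metaE r.
  by comp.
move=> r; have [mE cE] := metaE r; have [hS iS _] := spS r.
have tst : frame_test D (projT1 (S r), (meta r).2) (dwit (ex_minn (H r))).
  by rewrite -mE; case: ex_minnP.
split.
- by have [] := andP tst.
- rewrite /tauS (frame_size D4 cE iS tst) rmorphM fmorphV /= !ratr_nat.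
  by [].
by move=> rho hr; exact: (frame_weight_close D4 cE tst hr).
Qed.

(** Let [a] approximate the sum within [d = 4^-k / 4]. Once a partial sum exceeds [a - 2 d], what
    remains is at most [(a + d) - (a - 2 d) = 3 d], below [4^-k]. *)
Lemma tail_modulus (R : realType) (tau : nat -> rat) : computable tau -> (forall j, 0 <= tau j) ->
  cvgn (series (fun r => ratr (tau r) : R)) ->
  computable_real (limn (series (fun r => ratr (tau r) : R))) ->
  exists2 N, computable N & forall k r, (4 ^ k)%:R * \sum_(N k <= j < r) tau j <= 1.
Proof.
move=> ct t0 cv [e [h [hh nm]]]; set alpha := limn _ in nm.
pose a k := decodeQ (h (2 * k).+2).
have ca : computable a.
  apply: computable_unpickle; first exact: decodable_rat.
  by apply: (@computable_comp _ _ _ h (fun k => (2 * k).+2)); [exists e | comp].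
pose d k : rat := (2 ^ (2 * k).+2)%:R^-1.
have serE n : series (fun r => ratr (tau r) : R) n = ratr (csum tau 0 n).
  by rewrite csumE rmorph_sum.
have le_alpha n : ratr (csum tau 0 n) <= alpha.
  rewrite -serE; apply: nondecreasing_cvgn_le => //; apply/nondecreasing_seqP => m.
  by rewrite /series /= big_nat_recr //= lerDl ler0q.
have nma k : `|alpha - ratr (a k)| <= ratr (d k).
  by have := nm (2 * k).+2; rewrite /d fmorphV /= ratr_nat natrX.
have d0 k : 0 < d k by rewrite invr_gt0 ltr0n expn_gt0.
(* The sum is at least [a k - d k]; subtracting [2 d] makes the inequality strict, so partial sums
   eventually satisfy it. *)
have H k : exists n, a k - 2 * d k < csum tau 0 n.
  have lt : ratr (a k - 2 * d k) < alpha.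
    have := nma k; rewrite ler_norml rmorphB rmorphM /= ratr_nat.
    have : 0 < ratr (d k) :> R by rewrite ltr0q.
    by lra.
  have [n _ hn] := cvgr_gt _ cv _ lt.
  by exists n; have := hn n (leqnn n); rewrite /= serE ltr_rat.
exists (fun k => ex_minn (H k)).
  have cd : computable d by rewrite /d; comp.
  apply: computable_min; apply: computable_lt_rat; last by apply: computable_csum => //; comp.
  apply: computable_addq; first by apply: (computable_comp ca); comp.
  apply: computable_oppq; apply: computable_mulq; first exact: computable_const.
  by apply: (computable_comp cd); comp.
move=> k r; case: ex_minnP => n hn _.
have [rn|nr] := leqP r n; first by rewrite big_geq // mulr0.
have -> : \sum_(n <= j < r) tau j = csum tau 0 r - csum tau 0 n.
  by rewrite !csumE (big_cat_nat (leq0n n) (ltnW nr)) /= addrAC subrr add0r.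
have lt3 : csum tau 0 r - csum tau 0 n <= 3 * d k.
  rewrite -(ler_rat R) rmorphB rmorphM /= ratr_nat.
  have := le_alpha r; have := nma k; move: hn; rewrite ler_norml -(ltr_rat R) rmorphB rmorphM /= ratr_nat.
  by lra.
have dE : (4 ^ k)%:R * d k = 4^-1.
  have E : (2 ^ (2 * k).+2 = 4 ^ k * 4)%N by rewrite -[(2 * k).+2]addn2 expnD expnM.
  have nz : (4 ^ k)%:R != 0 :> rat by rewrite pnatr_eq0 -lt0n expn_gt0.
  by rewrite /d E natrM invfM mulrA (mulfV nz) mul1r.
have p4 : 0 <= (4 ^ k)%:R :> rat by [].
have := ler_wpM2l p4 lt3; rewrite mulrCA dE; lra.
Qed.

Lemma log2_word_bound (R : realType) (a n f : nat) : (0 < f)%N ->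
  (2 ^ a)%:R * (f%:R * (2 ^ n)%:R^-1) < 8 :> rat -> a%:R + log2 f%:R < n%:R + 3 :> R.
Proof.
move=> f0; rewrite mulrA ltr_pdivrMr ?ltr0n ?expn_gt0 // => h.
have {}h : (2 ^ a * f)%:R < (2 ^ (n + 3))%:R :> R.
  have -> : (2 ^ (n + 3) = 8 * 2 ^ n)%N by rewrite addnC expnD.
  by rewrite ltr_nat -(ltr_nat rat) !natrM.
have l2 : 0 < ln 2 :> R by rewrite ln_gt0 // ltr1n.
rewrite /log2 -(ltr_pM2r l2) mulrDl mulfVK ?gt_eqF //.
have lnp m : ln ((2 ^ m)%:R : R) = m%:R * ln 2 by rewrite natrX lnXn // mulr_natl.
rewrite -natrD -!lnp -lnM ?posrE ?ltr0n ?expn_gt0 // -natrM.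
by rewrite ltr_ln ?posrE ?ltr0n ?muln_gt0 ?expn_gt0 ?f0.
Qed.

Unset Implicit Arguments.

Theorem mainTheorem13 (R : realType) (U : prog)
    (rho : forall n : nat, 'M[complex R]_(2 ^ n)) :
  universal_prefix_free U ->
  is_state rho ->
  (forall eps : R, 0 < eps ->
     exists c : R, forall n : nat, ((n%:R - c)%:E < QK U eps (rho n))%E) ->
  forall s : rat, 0 < s < 1 ->
  forall phi : R -> R, admissible (ratr s) phi ->
  forall S : nat -> {n : nat & 'M[complex R]_(2 ^ n)},
    phi_s_test (ratr s) phi S -> passes rho S.
Proof.
move=> [_ univ] [dens _] hQK s _ phi _ S [[cS spS cv] _ _ csum_real] eps eps0 fails.
(* The first summand makes [8 / D] smaller than [eps / 2], the second ensures [4 < D]. *)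
pose D := ((Num.truncn (16 / eps)).+1 + 5)%N.
have D4 : (4 < D)%N by rewrite /D addnC.
have D0 : 0 < D%:R :> R by rewrite ltr0n; apply: leq_trans D4.
have D8 : 8 / D%:R < eps / 2.
  have : 16 / eps < D%:R.
    by apply: lt_le_trans (truncnS_gt _) _; rewrite ler_nat leq_addr.
  by rewrite !ltr_pdivrMr // => h; rewrite mulrAC ltr_pdivlMr // mulrC; lra.
have [F [cF cn hF]] := test_frames D4 cS spS.
pose tau r : rat := (size (F r))%:R * (2 ^ projT1 (S r))%:R^-1.
have ctau : computable tau by rewrite /tau; comp.
have tau0 j : 0 <= tau j by rewrite mulr_ge0 ?invr_ge0.
have tauE : (fun m => tauS (S m)) = (fun r => ratr (tau r)).
  by apply/funext => r; case: (hF r).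
rewrite tauE in cv csum_real.
have [N cN tailN] := tail_modulus ctau tau0 cv csum_real.
have cout : computable (fun r => codeF (F r)) := computable_comp computable_codeF cF.
have [M pfM hM] := prefix_free_machine ctau cN cout tau0 tailN.
have [pre hpre] := univ M pfM.
have eps2 : 0 < eps / 2 by rewrite divr_gt0.
have [c hc] := hQK _ eps2.
(* The description has length below [|pre| + n + 3 - k], which this [k] pushes below [n - c]. *)
pose k := (Num.truncn (`|c + (size pre)%:R + 3|)).+1.
have hk : c + (size pre)%:R + 3 < k%:R.
  exact: le_lt_trans (ler_norm _) (truncnS_gt _).
have [r [Nr rhor]] := fails (N k).
have [qF _ wF] := hF r; have {}wF := wF rho (dens _).
set n := projT1 (S r) in qF wF.
have wgt : eps / 2 < \sum_(v <- frame_vecs R (2 ^ n) (F r)) complex.Re ((adj v *m rho n *m v) 0 0).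
  by apply: lt_le_trans wF; lra.
(* An empty family has weight 0. So [tau r > 0], and [r] does have an interval and a word. *)
have F0 : (0 < size (F r))%N.
  rewrite lt0n; apply/negP => /eqP/size0nil Fr.
  by move: wgt; rewrite /frame_vecs Fr big_nil; lra.
have tr : 0 < tau r by rewrite mulr_gt0 ?invr_gt0 ?ltr0n ?expn_gt0.
have [sigma run lsig] := hM k r Nr tr.
have := hc n; apply/negP; rewrite -leNgt.
apply: (@le_trans _ _ ((size (pre ++ sigma))%:R + log2 (size (F r))%:R)%:E).
  apply: ereal_inf_lbound; exists (pre ++ sigma), (frame_vecs R (2 ^ n) (F r)).
  split; last by rewrite size_map.
  exists (codeF (F r)); split => //.
  - exact/hpre.
  - exact: codesVecs_codeF.
  - exact: frame_orthonormal.
  - exact: frame_vecs_algebraic.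
rewrite lee_fin size_cat natrD.
have := log2_word_bound R F0 lsig; rewrite natrD; lra.
Qed.
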